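(* Let $m,n,q,s$ be positive integers, $M\in\mathbb R^{m\times n}$, $\mu\in\mathbb R$, $\sigma>0$, $y\ge0$, and let $G\in\mathcal G_{\mu,\sigma}^{q\times m}$ and $H\in\mathcal G_{\mu,\sigma}^{n\times s}$ be Gaussian random matrices. For all integers $j$, $1\le j\le q$, and $k$, $1\le k\le s$, let $$M_j=M\begin{pmatrix}I_j\\ O_{n-j,j}\end{pmatrix},\qquad M^{(k)}=(I_k~|~O_{k,m-k})M$$ be the matrices of the first $j$ columns and of the first $k$ rows of $M$, respectively, and suppose that $\mathrm{rank}(M_j)=j$ and $\mathrm{rank}(M^{(k)})=k$ for all these $j$ and $k$. Then: (i) with probability $1$ the matrix $GM$ (respectively, $MH$) has generic rank profile if $\mathrm{rank}(M)\ge q$ (respectively, if $\mathrm{rank}(M)\ge s$); (ii) for all $j$ with $1\le j\le q$, $F_{1/\|((GM)_j^{(j)})^+\|}(y)\le 2.35\,y\,\sqrt j\,\|M_j^+\|/\sigma$ if $\mathrm{rank}(M)\ge j$, and for all $k$ with $1\le k\le s$, $F_{1/\|((MH)_k^{(k)})^+\|}(y)\le 2.35\,y\,\sqrt k\,\|(M^{(k)})^+\|/\sigma$ if $\mathrm{rank}(M)\ge k$.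
   Context: $\mathcal G_{\mu,\sigma}^{a\times b}$ is the set of $a\times b$ random matrices whose entries are independent real Gaussian random variables with mean $\mu$ and variance $\sigma^2$. $B_i^{(i)}$ is the leading (northwestern) $i\times i$ block of a matrix $B$. A matrix of rank $\rho$ has generic rank profile if its leading $i\times i$ blocks are nonsingular for $i=1,\dots,\rho$. $\|\cdot\|$ is the spectral norm, $B^+$ the Moore–Penrose pseudo-inverse, $F_\gamma(y)=\mathrm{Probability}\{\gamma\le y\}$, $I_j$ the identity matrix and $O_{a,b}$ the $a\times b$ zero matrix. *)

(* Defs.v *)
From HB Require Import structures.
From mathcomp Require Import all_boot all_order all_algebra.
From mathcomp Require Import all_classical all_reals all_analysis.

Set Implicit Arguments.
Unset Strict Implicit.
Unset Printing Implicit Defensive.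

Import Order.TTheory GRing.Theory Num.Theory.
Import numFieldNormedType.Exports.

Local Open Scope classical_set_scope.
Local Open Scope ring_scope.

(* For j <= b, [pid_mx j : 'M_(b, j)] is the block matrix (I_j ; O_{b-j,j});
   likewise [pid_mx k : 'M_(k, a)] is (I_k | O_{k,a-k}) for k <= a.  For larger
   j or k the extra columns or rows of the products below are zero, so that
   the rank condition rank (M_j) = j (or rank (M^(k)) = k) then fails. *)
Definition first_cols {R : pzSemiRingType} {a b : nat} (j : nat)
  (M : 'M[R]_(a, b)) : 'M[R]_(a, j) := M *m (pid_mx j : 'M[R]_(b, j)).

Definition first_rows {R : pzSemiRingType} {a b : nat} (k : nat)
  (M : 'M[R]_(a, b)) : 'M[R]_(k, b) := (pid_mx k : 'M[R]_(k, a)) *m M.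

Definition leading_block {R : pzSemiRingType} {a b : nat} (i : nat)
  (B : 'M[R]_(a, b)) : 'M[R]_i := first_rows i (first_cols i B).

Definition generic_rank_profile {F : fieldType} {a b : nat}
    (B : 'M[F]_(a, b)) : Prop :=
  forall i : nat, (1 <= i <= \rank B)%N -> leading_block i B \in unitmx.

(* The library norm on matrices is the entrywise max norm, hence the
   following definitions of the Euclidean and spectral norms. *)
Definition l2norm {R : realType} {n : nat} (x : 'cV[R]_n) : R :=
  Num.sqrt (\sum_(i < n) x i 0 ^+ 2).

Definition spectral_norm {R : realType} {a b : nat} (B : 'M[R]_(a, b)) : R :=
  sup [set l2norm (B *m x) | x in [set x : 'cV[R]_b | l2norm x = 1]].

(* The four Penrose equations over the reals.  (The library's [pinvmx] is a
   generalized inverse, but not the Moore-Penrose one.) *)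
Definition is_moore_penrose {R : realType} {a b : nat} (B : 'M[R]_(a, b))
    (X : 'M[R]_(b, a)) : Prop :=
  [/\ B *m X *m B = B, X *m B *m X = X,
      (B *m X)^T = B *m X & (X *m B)^T = X *m B].

Definition moore_penrose {R : realType} {a b : nat} (B : 'M[R]_(a, b)) :
  'M[R]_(b, a) := xget 0 [set X | is_moore_penrose B X].

Lemma is_moore_penrose_inj {R : realType} {a b : nat} (B : 'M[R]_(a, b))
    (X Y : 'M[R]_(b, a)) :
  is_moore_penrose B X -> is_moore_penrose B Y -> X = Y.
Proof.
move=> [BXB XBX BXt XBt] [BYB YBY BYt YBt].
have eBX : B *m X = B *m Y.
  rewrite -[LHS]BXt -{1}BYB -[B *m Y *m B *m X]mulmxA trmx_mul BXt BYt.
  by rewrite mulmxA BXB.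
have eXB : X *m B = Y *m B.
  rewrite -[LHS]XBt -{1}BYB mulmxA -mulmxA mulmxA.
  rewrite [X *m (B *m Y)]mulmxA -[X *m B *m Y *m B]mulmxA trmx_mul XBt YBt.
  by rewrite -mulmxA [B *m (X *m B)]mulmxA BXB.
by rewrite -XBX eXB -mulmxA eBX mulmxA YBY.
Qed.

Lemma row_free_gram_unit {R : realType} {a b : nat} (F : 'M[R]_(a, b)) :
  row_free F -> F *m F^T \in unitmx.
Proof.
move=> freeF; rewrite -row_free_unit -kermx_eq0; apply/rowV0P => v.
move=> /sub_kermxP; rewrite mulmxA => vFF.
suff vF0 : v *m F = 0 by apply: (row_free_inj freeF); rewrite vF0 mul0mx.
have : (v *m F) *m (v *m F)^T = 0 by rewrite trmx_mul mulmxA vFF mul0mx.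
move=> /matrixP/(_ 0 0); rewrite !mxE => /eqP.
rewrite psumr_eq0 => [/allP vF0|i _]; last by rewrite !mxE -expr2 sqr_ge0.
apply/rowP => i; have := vF0 i (mem_index_enum _).
by rewrite !mxE -expr2 sqrf_eq0 => /eqP.
Qed.

Lemma moore_penroseP {R : realType} {a b : nat} (B : 'M[R]_(a, b)) :
  is_moore_penrose B (moore_penrose B).
Proof.
suff [X BX] : exists X, is_moore_penrose B X.
  exact: (@xgetPex _ 0 [set X | is_moore_penrose B X] (ex_intro _ X BX)).
have [r [C [F [-> fullC freeF]]]] : exists (r : nat) (C : 'M[R]_(a, r))
    (F : 'M[R]_(r, b)), [/\ B = C *m F, row_full C & row_free F].
  exists (\rank B), (col_base B), (row_base B).
  by rewrite mulmx_base col_base_full row_base_free.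
have FFu := row_free_gram_unit freeF.
have CCu : C^T *m C \in unitmx.
  have := @row_free_gram_unit R _ _ C^T; rewrite trmxK; apply.
  by rewrite /row_free mxrank_tr.
pose K := invmx (F *m F^T); pose L := invmx (C^T *m C).
have KE : F *m (F^T *m K) = 1%:M by rewrite mulmxA mulmxV.
have LE : (L *m C^T) *m C = 1%:M by rewrite -mulmxA mulVmx.
have Kt : K^T = K by rewrite /K trmx_inv trmx_mul trmxK.
have Lt : L^T = L by rewrite /L trmx_inv trmx_mul trmxK.
exists ((F^T *m K) *m (L *m C^T)).
have E1 : (C *m F) *m ((F^T *m K) *m (L *m C^T)) = C *m (L *m C^T).
  by rewrite -mulmxA [F *m _]mulmxA KE mul1mx.
have E2 : ((F^T *m K) *m (L *m C^T)) *m (C *m F) = F^T *m K *m F.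
  by rewrite -mulmxA [(L *m C^T) *m _]mulmxA LE mul1mx.
split.
- by rewrite E1 -mulmxA [(L *m C^T) *m _]mulmxA LE mul1mx.
- by rewrite E2 -mulmxA [F *m _]mulmxA KE mul1mx.
- by rewrite E1 !trmx_mul trmxK Lt mulmxA.
- by rewrite E2 !trmx_mul trmxK Kt mulmxA.
Qed.

Section random_matrices.
Context {d : measure_display} {T : measurableType d} {R : realType}.
Variable P : probability T R.

Definition mutually_independent {I : finType} (X : I -> {RV P >-> R}) : Prop :=
  forall (J : {set I}) (A : I -> set R),
    (forall i, i \in J -> measurable (A i)) ->
    (P (\bigcap_(i in [set` J]) (X i @^-1` A i)) =
     \prod_(i in J) P (X i @^-1` A i))%E.

(* The second parameter of [normal_prob] is the standard deviation. *)
Definition has_normal_law (mu sigma : R) (X : {RV P >-> R}) : Prop :=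
  forall A : set R, measurable A -> distribution P X A = normal_prob mu sigma A.

Definition gaussian_matrix {a b : nat} (mu sigma : R)
    (G : 'M[{RV P >-> R}]_(a, b)) : Prop :=
  (forall i j, has_normal_law mu sigma (G i j)) /\
  mutually_independent (fun ij : 'I_a * 'I_b => G ij.1 ij.2).

Definition sample {a b : nat} (G : 'M[{RV P >-> R}]_(a, b)) (t : T) :
  'M[R]_(a, b) := \matrix_(i < a, j < b) G i j t.

Definition prob_le (gamma : T -> R) (y : R) : \bar R :=
  P [set t | gamma t <= y].

End random_matrices.

(* Main.v *)
Require Import Defs.
From HB Require Import structures.
From mathcomp Require Import all_boot all_order all_algebra.
From mathcomp Require Import all_classical all_reals all_analysis.
From mathcomp Require Import measurable_realfun ring lra.

(* The leading j x j block of GM is N = Y M_j, where Y consists of the first j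
   rows of G and |v| <= |M_j^+| |M_j v|.  For a fixed vector w, rotate the rows
   of Y by an orthogonal matrix sending w to a multiple of e_0; since Gaussian
   matrices are rotation invariant, one may take w = |w| e_0.  Then
   det N = <g, M_j p>, where g is the first row of Y and p = (adj N) e_0 depends
   only on the other rows, hence is independent of g, and the density bound for
   the Gaussian variable <g, M_j p> gives
     P(tau |det N| <= |(adj N) w|) <= sqrt(2/pi) |w| |M_j^+| / (sigma tau).
   By induction on j it also gives det N <> 0 almost surely.  Following Sankar,
   Spielman and Teng, now let w be Gaussian and independent of Y: there is a u
   with |u| >= |N^-1| and |N^-1 w| >= |<u, w>|, and |<u, w>| >= 3/4 sigma |u|
   with a probability that does not depend on u, while E|w| <= sigma sqrt j.
   A Gaussian w, instead of a uniform unit vector, makes the law of <u, w>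
   exact; the value 3/4 of the threshold is good enough for the constant
   2.35. *)

Set Implicit Arguments.
Unset Strict Implicit.
Unset Printing Implicit Defensive.

Import Order.TTheory GRing.Theory Num.Theory.
Import numFieldNormedType.Exports.

Local Open Scope classical_set_scope.
Local Open Scope ring_scope.

(** * Rotations of the Gaussian plane *)

Section gaussian_plane.
Context {R : realType}.
Local Notation leb := (@lebesgue_measure R).
Local Notation mR := (measurableTypeR R).

(** The density bound for a Gaussian variable does not see its mean, and the vector w is a centred
    column of a second copy of the matrix itself, so an arbitrary mean costs nothing; it is only
    carried along as a matrix, because rotations mix its entries. The bounds for a fixed vector use
    tau |det N| <= |(adj N) w| instead of the inverse: both sides are built from polynomials in the
    entries of N, and the singular case needs no convention. The matrix M enters only through a
    constant K with |v| <= K |M v|, a property inherited when a column is deleted. Rotation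
    invariance is proved for rotations of two coordinates, by one-variable substitutions, and passes
    to products. Comparing the two orders of integration over the two copies gives the constant
    sqrt(2/pi) (4/3) / p, where p is the probability that a standard Gaussian variable is at least
    3/4 in absolute value. It is about 2.347, so that sharp numerical bounds on pi and on p are
    required. *)

Definition normal_law (m s : R) : probability mR R := @normal_prob R m s.

(** The Radon-Nikodym derivative and [normal_pdf] have the same integral over every measurable set,
    hence agree almost everywhere. *)
Lemma integral_normal_law (m s : R) (f : mR -> \bar R) : s != 0 ->
  measurable_fun setT f -> (forall x, 0 <= f x)%E ->
  (\int[normal_law m s]_x f x = \int[leb]_x (f x * (normal_pdf m s x)%:E))%E.
Proof.
move=> s0 mf f0; have dom := @normal_prob_dominates R m s.
rewrite -(Radon_Nikodym_SigmaFinite.change_of_variables dom)//=.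
have iRN := Radon_Nikodym_SigmaFinite.f_integrable dom.
have mpdf : measurable_fun setT (fun x : mR => (normal_pdf m s x)%:E).
  by apply/measurable_EFinP; exact: measurable_normal_pdf.
apply: ae_eq_integral => //.
- by apply: emeasurable_funM => //; exact: measurable_int iRN.
- exact: emeasurable_funM.
- apply: ae_eqe_mul2l => /=; apply: integral_ae_eq => // E _ mE.
  by rewrite -(Radon_Nikodym_SigmaFinite.f_integral dom).
Qed.

(** The image of Lebesgue measure under the affine map, scaled by |k|, gives each half-open interval
    its length, so it is Lebesgue measure by uniqueness. *)
Lemma integral_affine (k b : R) (f : mR -> \bar R) : k != 0 ->
  measurable_fun setT f -> (forall x, 0 <= f x)%E ->
  (\int[leb]_x f x = `|k|%:E * \int[leb]_x f (k * x + b)%R)%E.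
Proof.
move=> k0 mf f0.
pose phi : mR -> mR := fun x => (k * x + b)%R.
have mphi : measurable_fun setT phi.
  by apply: measurable_funD => //; exact: measurable_funM.
have := @ge0_integral_pushforward _ _ _ _ R phi mphi leb setT f measurableT mf.
rewrite preimage_setT => <-; last by move=> y _; exact: f0.
rewrite -(@ge0_integral_mscale _ _ _ _ setT measurableT (NngNum (normr_ge0 k)))//.
apply: eq_measure_integral => A mA _.
apply: lebesgue_measure_unique => // _ [[a c]] _ <-.
suff : leb `]a, c]%classic = (`|k|%:E * leb (phi @^-1` `]a, c]%classic))%E by [].
have [k_lt0|k_gt0|/eqP] := ltgtP k 0; last by rewrite (negbTE k0).
- rewrite (_ : phi @^-1` _ = `[((c - b) / k)%R, ((a - b) / k)%R[%classic); last first.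
    by apply/seteqP; split=> x; rewrite /= /phi !in_itv/= -ltrBlDr -lerBrDr
      ler_ndivrMr// ltr_ndivlMr// ![x * k]mulrC andbC.
  rewrite !lebesgue_measure_itv/= !lte_fin ltr_nM2r ?invr_lt0// ltrD2r.
  case: ifPn => ac; last by rewrite mule0.
  by rewrite ltr0_norm// -!EFinD -EFinM; congr EFin; field.
- rewrite (_ : phi @^-1` _ = `]((a - b) / k)%R, ((c - b) / k)%R]%classic); last first.
    by apply/seteqP; split=> x; rewrite /= /phi !in_itv/= -ltrBlDr -lerBrDr
      ltr_pdivrMr// ler_pdivlMr// ![x * k]mulrC.
  rewrite !lebesgue_measure_itv/= !lte_fin ltr_pM2r ?invr_gt0// ltrD2r.
  case: ifPn => ac; last by rewrite mule0.
  by rewrite gtr0_norm// -!EFinD -EFinM; congr EFin; field.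
Qed.

(** The rotation is a composite of two one-variable affine substitutions separated by an exchange of
    integrals: x = (v - c y) / s for fixed y, then y = c v - s u for fixed v. Their factors 1/|s|
    and |s| cancel. This is where s must be nonzero. *)
Lemma integral_plane_rotation (c s : R) (F : mR * mR -> \bar R) :
  s != 0 -> c ^+ 2 + s ^+ 2 = 1 ->
  measurable_fun setT F -> (forall z, 0 <= F z)%E ->
  (\int[leb]_y \int[leb]_x F (x, y) =
   \int[leb]_v \int[leb]_u F (c * u + s * v, c * v - s * u)%R)%E.
Proof.
move=> s0 cs mF F0.
have mG : measurable_fun setT (fun z : mR * mR =>
    F (s^-1 * z.2 + - (c * z.1 / s), z.1)).
  apply: measurableT_comp => //; apply: measurable_fun_pair => //.
  apply: measurable_funD; first exact: measurable_funM.
  by apply: measurableT_comp => //; apply: measurable_funM => //; exact: measurable_funM.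
under eq_integral => y _.
  rewrite (@integral_affine s^-1 (- (c * y / s)) (fun x => F (x, y))) ?invr_eq0//.
    over.
  exact: measurableT_comp.
rewrite ge0_integralZl//; last 2 first.
- exact: (measurable_fun_fubini_tonelli_F (fun z : mR * mR =>
    F (s^-1 * z.2 + - (c * z.1 / s), z.1))).
- by move=> y _; exact: integral_ge0.
rewrite (fubini_tonelli (fun z : mR * mR =>
    F (s^-1 * z.2 + - (c * z.1 / s), z.1)))//=.
under eq_integral => v _.
  rewrite (@integral_affine (- s) (c * v)
    (fun y => F (s^-1 * v + - (c * y / s), y))) ?oppr_eq0//.
    over.
  exact: (measurable_fun_pair1 v mG).
rewrite ge0_integralZl//; last 2 first.
- have mG' : measurable_fun setT (fun z : mR * mR =>
    F (s^-1 * z.1 + - (c * (- s * z.2 + c * z.1) / s), - s * z.2 + c * z.1)).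
    have m1 : measurable_fun setT (fun z : mR * mR => (- s * z.2 + c * z.1)).
      by apply: measurable_funD => //; exact: measurable_funM.
    apply: measurableT_comp => //; apply: measurable_fun_pair => //.
    apply: measurable_funD; first exact: measurable_funM.
    by apply: measurableT_comp => //; apply: measurable_funM => //; exact: measurable_funM.
  exact: (measurable_fun_fubini_tonelli_F (fun z : mR * mR =>
    F (s^-1 * z.1 + - (c * (- s * z.2 + c * z.1) / s), - s * z.2 + c * z.1))).
- by move=> y _; exact: integral_ge0.
rewrite muleA -EFinM normrN -normrM mulVf// normr1 mul1e.
apply: eq_integral => v _; apply: eq_integral => u _; congr (F (_, _)).
  have -> : s^-1 * v = (c ^+ 2 + s ^+ 2) * s^-1 * v by rewrite cs mul1r.
  by field.
by ring.
Qed.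

Definition rotate2 (c s : R) (z : mR * mR) : mR * mR :=
  (c * z.1 - s * z.2, s * z.1 + c * z.2).

Lemma measurable_rotate2 (c s : R) : measurable_fun setT (rotate2 c s).
Proof.
apply: measurable_fun_pair => /=.
  by apply: measurable_funB; exact: measurable_funM.
by apply: measurable_funD; exact: measurable_funM.
Qed.

(** The exponents add up to a squared distance to the mean point, which a rotation preserves; both
    coordinates must share the same standard deviation. *)
Lemma normal_pdfM_rotation (c s m1 m2 r u v : R) :
  c ^+ 2 + s ^+ 2 = 1 -> r != 0 ->
  normal_pdf m1 r (c * u + s * v) * normal_pdf m2 r (c * v - s * u) =
  normal_pdf (c * m1 - s * m2) r u * normal_pdf (s * m1 + c * m2) r v.
Proof.
move=> cs r0; rewrite !normal_pdfE// mulrACA [RHS]mulrACA; congr (_ * _).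
rewrite /normal_fun -2!expRD; congr expR.
rewrite -[in LHS]mulrDl -[in RHS]mulrDl; congr (_ * _).
(* In each expanded square, the factor 1 of the square that lacks c and s is replaced by c^2 + s^2;
   the remaining identity is then polynomial and holds without the relation between c and s. *)
have -> : (u - (c * m1 - s * m2)) ^+ 2 =
    (c ^+ 2 + s ^+ 2) * u ^+ 2 - 2 * u * (c * m1 - s * m2) + (c * m1 - s * m2) ^+ 2.
  by rewrite cs; ring.
have -> : (v - (s * m1 + c * m2)) ^+ 2 =
    (c ^+ 2 + s ^+ 2) * v ^+ 2 - 2 * v * (s * m1 + c * m2) + (s * m1 + c * m2) ^+ 2.
  by rewrite cs; ring.
have -> : (c * u + s * v - m1) ^+ 2 =
    (c * u + s * v) ^+ 2 - 2 * (c * u + s * v) * m1 + (c ^+ 2 + s ^+ 2) * m1 ^+ 2.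
  by rewrite cs; ring.
have -> : (c * v - s * u - m2) ^+ 2 =
    (c * v - s * u) ^+ 2 - 2 * (c * v - s * u) * m2 + (c ^+ 2 + s ^+ 2) * m2 ^+ 2.
  by rewrite cs; ring.
by ring.
Qed.

Lemma normal_law_rotation (c s m1 m2 r : R) (A B : set mR) :
  s != 0 -> c ^+ 2 + s ^+ 2 = 1 -> r != 0 -> measurable A -> measurable B ->
  ((normal_law m1 r \x normal_law m2 r) (rotate2 c s @^-1` (A `*` B)) =
   normal_law (c * m1 - s * m2) r A * normal_law (s * m1 + c * m2) r B)%E.
Proof.
move=> s0 cs r0 mA mB; set E := rotate2 c s @^-1` (A `*` B).
have mE : measurable E.
  by rewrite -[E]setTI; apply: measurable_rotate2 => //; exact: measurableX.
have mpdf m : measurable_fun setT (fun x : mR => (normal_pdf m r x)%:E).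
  by apply/measurable_EFinP; exact: measurable_normal_pdf.
have p0 m x : (0 <= (normal_pdf m r x)%:E)%E by rewrite lee_fin normal_pdf_ge0.
have mI : measurable_fun setT (fun z : mR * mR => (\1_E z : R)%:E).
  by apply/measurable_EFinP; exact: measurable_indic.
have I0 (z : mR * mR) : (0 <= (\1_E z : R)%:E)%E by rewrite lee_fin.
pose F (z : mR * mR) : \bar R :=
  ((\1_E z)%:E * (normal_pdf m1 r z.1)%:E * (normal_pdf m2 r z.2)%:E)%E.
transitivity (\int[leb]_y \int[leb]_x F (x, y))%E.
  rewrite -(setIT E) -(integral_indic (normal_law m1 r \x normal_law m2 r)%E)//.
  rewrite (fubini_tonelli2 (fun z => (\1_E z)%:E))//=.
  rewrite integral_normal_law//; last 2 first.
  - exact: (measurable_fun_fubini_tonelli_G (fun z => (\1_E z)%:E)).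
  - by move=> y; exact: integral_ge0.
  apply: eq_integral => y _; rewrite /fubini_G.
  have my : measurable_fun setT (fun x : mR => (\1_E (x, y) : R)%:E).
    exact: (measurable_fun_pair1 y mI).
  rewrite integral_normal_law// -ge0_integralZr//.
  - exact: emeasurable_funM.
  - by move=> x _; rewrite mule_ge0.
rewrite (integral_plane_rotation s0 cs)/=; last 2 first.
- apply: emeasurable_funM; first apply: emeasurable_funM => //.
    exact: (measurableT_comp (mpdf m1)).
  exact: (measurableT_comp (mpdf m2)).
- by move=> z; rewrite !mule_ge0.
transitivity (\int[leb]_v \int[leb]_u
   (((\1_A u)%:E * (normal_pdf (c * m1 - s * m2) r u)%:E) *
   ((\1_B v)%:E * (normal_pdf (s * m1 + c * m2) r v)%:E)))%E.
  apply: eq_integral => v _; apply: eq_integral => u _; rewrite /F -!EFinM.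
  congr EFin; rewrite -mulrA normal_pdfM_rotation// [RHS]mulrACA; congr (_ * _).
  rewrite !indicE -natrM mulnb; congr (nat_of_bool _)%:R.
  have Euv : E (c * u + s * v, c * v - s * u) = (A u /\ B v).
    rewrite /E /rotate2 /setX /preimage/=; congr (A _ /\ B _).
      by transitivity ((c ^+ 2 + s ^+ 2) * u); [ring|rewrite cs mul1r].
    by transitivity ((c ^+ 2 + s ^+ 2) * v); [ring|rewrite cs mul1r].
  apply/idP/andP; first by rewrite inE Euv => -[? ?]; rewrite !inE.
  by rewrite !inE Euv.
under eq_integral => v _.
  rewrite ge0_integralZr//; first over.
  - apply: emeasurable_funM => //.
    by apply/measurable_EFinP; exact: measurable_indic.
  - by move=> x _; rewrite mule_ge0// lee_fin.
  - by rewrite mule_ge0// lee_fin.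
have intA m (C : set mR) : measurable C ->
  (\int[leb]_u ((\1_C u)%:E * (normal_pdf m r u)%:E) = normal_law m r C)%E.
  move=> mC; rewrite -integral_normal_law//.
    by rewrite integral_indic// setIT.
  by apply/measurable_EFinP; exact: measurable_indic.
rewrite intA// ge0_integralZl//; first by rewrite intA.
- apply: emeasurable_funM => //.
  by apply/measurable_EFinP; exact: measurable_indic.
- by move=> x _; rewrite mule_ge0// lee_fin.
Qed.
End gaussian_plane.

(** * Families of independent Gaussian variables *)

Section gaussian_families.
Context {d : measure_display} {T : measurableType d} {R : realType}.
Variable P : probability T R.
Local Notation mR := (measurableTypeR R).
Local Open Scope ereal_scope.

(** Laws and independence are merged into one product formula over the whole index set. Each
    variable has its own mean, since a rotation mixes the means; the standard deviation is common,
    as rotation invariance requires. *)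
Definition gaussian_family {I : finType} (mu : I -> R) (r : R)
    (X : I -> T -> mR) : Prop :=
  (forall i, measurable_fun setT (X i)) /\
  (forall A : I -> set mR, (forall i, measurable (A i)) ->
    P [set t | forall i, A i (X i t)] = \prod_(i : I) normal_law (mu i) r (A i)).

Lemma measurable_forall_fin (I : finType) (A : I -> set mR) (X : I -> T -> mR) :
  (forall i, measurable_fun setT (X i)) -> (forall i, measurable (A i)) ->
  measurable [set t | forall i, A i (X i t)].
Proof.
move=> mX mA.
rewrite (_ : [set t | _] = \bigcap_(i in [set: I]) (X i @^-1` A i)); last first.
  by apply/seteqP; split=> [t H i _|t H i]; exact: H.
apply: fin_bigcap_measurable => // i _.
by rewrite -[_ @^-1` _]setTI; exact: mX.
Qed.

Lemma gaussian_familyP {I : finType} (mu r : R) (X : I -> {RV P >-> R}) :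
  (forall i, has_normal_law mu r (X i)) -> mutually_independent X ->
  gaussian_family (fun=> mu) r X.
Proof.
move=> normX indX; split=> [i|A mA]; first exact: (@measurable_funPT _ _ _ _ (X i)).
rewrite (_ : [set t | _] = \bigcap_(i in [set` [set: I]%SET]) (X i @^-1` A i)).
  rewrite indX => [|i _]; last exact: mA.
  rewrite (eq_bigl xpredT) => [|i]; last by rewrite finset.in_setT.
  by apply: eq_bigr => i _; exact: (normX i (A i) (mA i)).
by apply/seteqP; split=> [t H i _|t H i]; apply: H; rewrite /= finset.in_setT.
Qed.

(** Coordinates outside the image of [f] are constrained only by the full line, which contributes a
    factor 1. *)
Lemma gaussian_family_sub {I J : finType} (f : J -> I) (mu : I -> R) (r : R)
    (X : I -> T -> mR) : injective f -> gaussian_family mu r X ->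
  gaussian_family (mu \o f) r (X \o f).
Proof.
move=> injf [mX indX]; split=> [j|A mA]; first exact: mX.
pose A' i : set mR := if [pick j | f j == i] is Some j then A j else setT.
have A'f j : A' (f j) = A j.
  rewrite /A'; case: pickP => [k /eqP/injf -> //|/(_ j)].
  by rewrite eqxx.
have A'N i : i \notin codom f -> A' i = setT.
  rewrite /A'; case: pickP => [k /eqP <-|//].
  by rewrite codom_f.
have mA' i : measurable (A' i) by rewrite /A'; case: pickP.
transitivity (P [set t | forall i, A' i (X i t)]).
  congr (P _); apply/seteqP; split=> t H.
    move=> i; have [/codomP[j ->]|iN] := boolP (i \in codom f).
      by rewrite A'f; exact: H.
    by rewrite A'N.
  by move=> j; have := H (f j); rewrite A'f.
rewrite indX// (bigID (mem (codom f)))/= [X in _ * X]big1 ?mule1; last first.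
  by move=> i iN; rewrite A'N// probability_setT.
rewrite (reindex_omap f (fun i => [pick j | f j == i]))/=; last first.
  by move=> i /codomP[j ->]; case: pickP => [k /eqP /= ->//|/(_ j)]; rewrite eqxx.
apply: eq_big => j.
  rewrite codom_f/=; case: pickP => [k /eqP/injf ->|/(_ j)]; last by rewrite eqxx.
  by rewrite eqxx.
by rewrite A'f.
Qed.

Lemma gaussian_family_marginal {I : finType} (mu : I -> R) (r : R)
    (X : I -> T -> mR) i (A : set mR) : gaussian_family mu r X -> measurable A ->
  P (X i @^-1` A) = normal_law (mu i) r A.
Proof.
move=> gX mA; have inj1 : injective (fun _ : 'I_1 => i) by move=> k l _; rewrite !ord1.
have [_ /(_ (fun=> A))] := gaussian_family_sub inj1 gX.
rewrite big_ord_recl big_ord0 mule1/= => <- //.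
by congr (P _); apply/seteqP; split=> t; [move=> At k|move=> /(_ ord0)].
Qed.

(** A rotation of two coordinates makes a rectangle slanted, so the product formula is needed for
    general planar sets. The law of the pair, restricted to the event on the other coordinates, is a
    multiple of the product measure on rectangles, hence everywhere. *)
Lemma gaussian_family_pair {I : finType} (mu : I -> R) (r : R)
    (X : I -> T -> mR) (a b : I) (A : I -> set mR) (C : set (mR * mR)) :
  a != b -> gaussian_family mu r X -> (forall i, measurable (A i)) ->
  measurable C ->
  P [set t | C (X a t, X b t) /\
             forall i, i != a -> i != b -> A i (X i t)] =
  (normal_law (mu a) r \x normal_law (mu b) r) C *
  \prod_(i | (i != a) && (i != b)) normal_law (mu i) r (A i).
Proof.
move=> ab [mX indX] mA mC.
pose box B1 B2 i := if i == a then B1 else if i == b then B2 else A i.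
have mbox B1 B2 : measurable B1 -> measurable B2 -> forall i, measurable (box B1 B2 i).
  by move=> mB1 mB2 i; rewrite /box; do 2?case: ifP.
pose E := [set t | forall i, box setT setT i (X i t)].
have EE : E = [set t | forall i, i != a -> i != b -> A i (X i t)].
  apply/seteqP; split=> t H i; last by rewrite /box;
    do 2?[case: eqVneq => // ?]; apply: H.
  by move=> /negbTE ia /negbTE ib; have := H i; rewrite /box ia ib.
have mE : measurable E by apply: measurable_forall_fin => //; exact: mbox.
pose Z t : mR * mR := (X a t, X b t).
have mZ : measurable_fun setT Z by apply: measurable_fun_pair; exact: mX.
pose p := \prod_(i | (i != a) && (i != b)) normal_law (mu i) r (A i).
have p_ge0 : 0 <= p by apply: prode_ge0 => i _; exact: measure_ge0.
have p_fin : p \is a fin_num by apply: prode_fin_num => i _; exact: fin_num_measure.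
pose pn := NngNum (fine_ge0 p_ge0).
pose m' : {measure set (mR * mR) -> \bar R} :=
  measure_function_pushforward__canonical__measure_function_Measure
    (mrestr P mE) mZ.
have m'X A1 A2 : measurable A1 -> measurable A2 -> m' (A1 `*` A2) =
    mscale pn (normal_law (mu a) r) A1 * normal_law (mu b) r A2.
  move=> mA1 mA2.
  transitivity (P [set t | forall i, box A1 A2 i (X i t)]).
    rewrite /m'/= /pushforward /mrestr; congr (P _); apply/seteqP; split=> t.
      move=> [[/= ZA1 ZA2]]; rewrite EE => Et i; rewrite /box.
      by case: eqVneq => [->//|ia]; case: eqVneq => [->//|ib]; exact: Et.
    move=> H; split; last first.
      rewrite EE => i /negbTE ia /negbTE ib.
      by have := H i; rewrite /box ia ib.
    by split; [have := H a|have := H b]; rewrite /box eqxx // eq_sym (negbTE ab).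
  rewrite indX; last exact: mbox.
  rewrite (bigD1 a)//= (bigD1 b)/=; last by rewrite eq_sym.
  have -> : box A1 A2 a = A1 by rewrite /box eqxx.
  have -> : box A1 A2 b = A2 by rewrite /box eq_sym (negbTE ab) eqxx.
  rewrite muleA muleC /mscale/= fineK// -muleA.
  congr (_ * _); apply: eq_bigr => i /andP[/negbTE ia /negbTE ib].
  by rewrite /box ia ib.
have := product_measure_unique m'X mC.
rewrite /product_measure1 ge0_integral_mscale//; last exact: measurable_fun_xsection.
rewrite /= fineK// muleC => ->.
rewrite /m'/= /pushforward /mrestr; congr (P _); apply/seteqP; split=> t.
  by move=> [Ct H]; split => //; rewrite EE.
by move=> [Ct]; rewrite EE.
Qed.

Definition rotate_pair {I : eqType} (a b : I) (c s : R)
    (x : I -> R) (i : I) : R :=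
  (if i == a then c * x a - s * x b
   else if i == b then s * x a + c * x b else x i)%R.

Lemma gaussian_family_rotate {I : finType} (mu : I -> R) (r : R)
    (X : I -> T -> mR) (a b : I) (c s : R) :
  a != b -> s != 0%R -> (c ^+ 2 + s ^+ 2 = 1)%R -> r != 0%R ->
  gaussian_family mu r X ->
  gaussian_family (rotate_pair a b c s mu) r
    (fun i t => rotate_pair a b c s (X ^~ t) i).
Proof.
move=> ab s0 cs r0 gX; have [mX indX] := gX; split=> [i|A mA].
  rewrite /rotate_pair; case: (i == a); last case: (i == b) => //.
    by apply: measurable_funB; apply: measurable_funM => //; exact: mX.
  by apply: measurable_funD; apply: measurable_funM => //; exact: mX.
pose C := rotate2 c s @^-1` (A a `*` A b).
have mC : measurable C.
  by rewrite -[C]setTI; apply: measurable_rotate2 => //; exact: measurableX.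
transitivity (P [set t | C (X a t, X b t) /\
             forall i, i != a -> i != b -> A i (X i t)]).
  congr (P _); apply/seteqP; split=> t.
    move=> H; split.
      by split; [have := H a|have := H b];
        rewrite /rotate_pair eqxx // eq_sym (negbTE ab).
    by move=> i /negbTE ia /negbTE ib; have := H i; rewrite /rotate_pair ia ib.
  move=> [[/= Ha Hb]] H i; rewrite /rotate_pair.
  by case: eqVneq => [->//|ia]; case: eqVneq => [->//|ib]; exact: H.
rewrite (gaussian_family_pair ab gX mA mC) normal_law_rotation//.
rewrite [RHS](bigD1 a)//= [X in _ = _ * X](bigD1 b)/=; last by rewrite eq_sym.
rewrite muleA {1 2}/rotate_pair !eqxx [b == a]eq_sym (negbTE ab); congr (_ * _).
apply: eq_bigr => i /andP[/negbTE ia /negbTE ib].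
by rewrite /rotate_pair ia ib.
Qed.

End gaussian_families.

(** * Gaussian matrices and orthogonal transformations *)

Section gaussian_matrices.
Context {d : measure_display} {T : measurableType d} {R : realType}.
Variable P : probability T R.
Local Notation mR := (measurableTypeR R).

(** [M0] is the matrix of means. It is arbitrary because a constant mean matrix does not stay
    constant under multiplication by an orthogonal matrix. *)
Definition gaussian_mx {a b : nat} (M0 : 'M[R]_(a, b)) (r : R)
    (Y : T -> 'M[R]_(a, b)) : Prop :=
  gaussian_family P (fun ik : 'I_a * 'I_b => M0 ik.1 ik.2) r
    (fun ik t => Y t ik.1 ik.2).

Definition givens {n : nat} (i1 i2 : 'I_n) (c s : R) : 'M[R]_n :=
  \matrix_(i, j) rotate_pair i1 i2 c s (fun k => (k == j)%:R) i.

Lemma givens_mulmxE (n b : nat) (i1 i2 : 'I_n) (c s : R) (A : 'M[R]_(n, b)) i k :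
  (givens i1 i2 c s *m A) i k = rotate_pair i1 i2 c s (A ^~ k) i.
Proof.
have sumd (l : 'I_n) : \sum_j (l == j)%:R * A j k = A l k.
  rewrite (bigD1 l)//= eqxx mul1r big1 ?addr0// => j jl.
  by rewrite eq_sym (negbTE jl) mul0r.
rewrite mxE; under eq_bigr do rewrite mxE.
rewrite /rotate_pair; case: (i == i1); last case: (i == i2).
- under eq_bigr do rewrite mulrBl -!mulrA.
  by rewrite sumrB -!mulr_sumr !sumd.
- under eq_bigr do rewrite mulrDl -!mulrA.
  by rewrite big_split/= -!mulr_sumr !sumd.
- exact: sumd.
Qed.

Lemma givens_orthogonal (n : nat) (i1 i2 : 'I_n) (c s : R) :
  i1 != i2 -> c ^+ 2 + s ^+ 2 = 1 ->
  (givens i1 i2 c s)^T *m givens i1 i2 c s = 1%:M.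
Proof.
move=> i12 cs.
have -> : (givens i1 i2 c s)^T = givens i1 i2 c (- s).
  apply/matrixP => i j; rewrite !mxE.
  (* The Kronecker delta is made opaque and known only by its values on and off the diagonal and its
     symmetry, so that each case is closed by [ring]. *)
  pose D (k l : 'I_n) : R := (k == l)%:R.
  have D1 k : D k k = 1 by rewrite /D eqxx.
  have D0 k l : k != l -> D k l = 0 by rewrite /D => /negbTE ->.
  have DC k l : D k l = D l k by rewrite /D eq_sym.
  change (rotate_pair i1 i2 c s (D ^~ i) j = rotate_pair i1 i2 c (- s) (D ^~ j) i).
  move: D D1 D0 DC => D D1 D0 DC; rewrite /rotate_pair.
  have i21 : i2 != i1 by rewrite eq_sym.
  have [->|ii1] := eqVneq i i1; have [->|ji1] := eqVneq j i1.
  - by rewrite D1 D0//; ring.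
  - have [->|ji2] := eqVneq j i2; first by rewrite !D1 !D0//; ring.
    by rewrite [D i1 j]DC [D i2 j]DC !D0//; ring.
  - have [->|ii2] := eqVneq i i2; first by rewrite !D1 !D0//; ring.
    by rewrite [D i1 i]DC [D i2 i]DC !D0//; ring.
  - have [->|ii2] := eqVneq i i2; have [->|ji2] := eqVneq j i2 => //.
    + by rewrite D1 D0//; ring.
    + by rewrite [D i1 j]DC [D i2 j]DC !D0//; ring.
    + by rewrite [D i1 i]DC [D i2 i]DC !D0//; ring.
apply/matrixP => i j; rewrite givens_mulmxE /rotate_pair !mxE /rotate_pair.
rewrite !eqxx ![i2 == i1]eq_sym (negbTE i12).
have [->|ii1] := eqVneq i i1; first by rewrite -[RHS]mul1r -cs; ring.
have [->|ii2] := eqVneq i i2; first by rewrite -[RHS]mul1r -cs; ring.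
by [].
Qed.

(** Left multiplication rotates the same two entries in every column. The matrix [Z l A] has only
    its first l columns rotated, and passing from l to l + 1 is a single rotation of two variables
    of the family. *)
Lemma gaussian_mx_givens (a b : nat) (i1 i2 : 'I_a) (c s r : R)
    (M0 : 'M[R]_(a, b)) (Y : T -> 'M[R]_(a, b)) :
  i1 != i2 -> s != 0 -> c ^+ 2 + s ^+ 2 = 1 -> r != 0 ->
  gaussian_mx M0 r Y ->
  gaussian_mx (givens i1 i2 c s *m M0) r (fun t => givens i1 i2 c s *m Y t).
Proof.
move=> i12 s0 cs r0 gY.
pose Z l (A : 'M[R]_(a, b)) : 'M[R]_(a, b) := \matrix_(i, k)
  (if (k < l)%N then rotate_pair i1 i2 c s (A ^~ k) i else A i k).
have ZS l A (lb : (l < b)%N) (ik : 'I_a * 'I_b) : Z l.+1 A ik.1 ik.2 =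
  rotate_pair (i1, Ordinal lb) (i2, Ordinal lb) c s (fun x => Z l A x.1 x.2) ik.
  case: ik => i k; rewrite /Z /rotate_pair !mxE /= !ltnn !xpair_eqE.
  rewrite -!(inj_eq val_inj)/= ltnS leq_eqVlt.
  by case: ltngtP => kl; rewrite ?andbF ?andbT //= ?(val_inj kl) //;
    rewrite (_ : k = Ordinal lb)//; apply: val_inj.
suff gZ l : (l <= b)%N -> gaussian_mx (Z l M0) r (Z l \o Y).
  have := gZ b (leqnn b); rewrite (_ : Z b M0 = givens i1 i2 c s *m M0).
    rewrite (_ : Z b \o Y = fun t => givens i1 i2 c s *m Y t)//.
    by apply/funext => t; apply/matrixP => i k; rewrite givens_mulmxE mxE ltn_ord.
  by apply/matrixP => i k; rewrite givens_mulmxE mxE ltn_ord.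
elim: l => [_|l IH lb].
  have Z0 A : Z 0%N A = A by apply/matrixP => i k; rewrite mxE.
  by rewrite Z0 (_ : Z 0%N \o Y = Y)//; apply/funext => t; rewrite /= Z0.
have i12l : (i1, Ordinal lb) != (i2, Ordinal lb) by rewrite xpair_eqE (negbTE i12).
have := gaussian_family_rotate i12l s0 cs r0 (IH (ltnW lb)).
rewrite /gaussian_mx; congr (gaussian_family P _ r _).
  by apply/funext => ik; rewrite ZS.
by apply/funext => ik; apply/funext => t; rewrite /= ZS.
Qed.

(** Invariance of the Gaussian law is carried along as a property of [Q]. It is stable under
    products, so products of Givens rotations have it and no factorization of a general orthogonal
    matrix is involved. *)
Definition gaussian_orthogonal {n : nat} (r : R) (Q : 'M[R]_n) : Prop :=
  Q^T *m Q = 1%:M /\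
  forall b (M0 : 'M[R]_(n, b)) Y, gaussian_mx M0 r Y ->
    gaussian_mx (Q *m M0) r (fun t => Q *m Y t).

(* A product of Givens rotations clears the entries of [w] one by one. *)
Lemma exists_gaussian_orthogonal (n : nat) (r : R) (w : 'cV[R]_n.+1) : r != 0 ->
  exists2 Q : 'M[R]_n.+1, gaussian_orthogonal r Q &
    exists l : R, Q *m w = l *: delta_mx 0 0.
Proof.
move=> r0.
suff : exists2 Q : 'M[R]_n.+1, gaussian_orthogonal r Q &
    forall i : 'I_n.+1, (0 < i <= n)%N -> (Q *m w) i 0 = 0.
  move=> [Q gQ Qw].
  exists Q => //; exists ((Q *m w) 0 0); apply/colP => i; rewrite !mxE eqxx andbT.
  have [->|i0] := eqVneq i 0; first by rewrite mulr1.
  rewrite mulr0; have := Qw i; rewrite mxE => -> //.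
  by rewrite lt0n -ltnS ltn_ord andbT; apply: contra i0 => /eqP i0; apply/eqP/val_inj.
suff : forall l, (l <= n)%N -> exists2 Q : 'M[R]_n.+1, gaussian_orthogonal r Q &
    forall i : 'I_n.+1, (0 < i <= l)%N -> (Q *m w) i 0 = 0.
  exact.
elim=> [_|l IH ln].
  exists 1%:M; last by case=> [[|i] ?].
  split=> [|b M0 Y gY]; first by rewrite trmx1 mul1mx.
  rewrite mul1mx (_ : (fun t => _) = Y)//.
  by apply/funext => t; rewrite mul1mx.
have [Q [QQ gQ] Qw] := IH (ltnW ln).
pose i2 : 'I_n.+1 := Ordinal (ln : (l.+1 < n.+1)%N).
have i2l (i : 'I_n.+1) : (0 < i <= l.+1)%N -> i = i2 \/ (0 < i <= l)%N.
  rewrite [(i <= _)%N]leq_eqVlt => /andP[i0 /orP[/eqP il|il]].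
    by left; apply: val_inj.
  by right; rewrite i0.
pose x := (Q *m w) 0 0; pose y := (Q *m w) i2 0.
(* An entry that already vanishes is left alone; otherwise the rotation below has s nonzero, as
   [gaussian_mx_givens] demands. *)
have [y0|y0] := eqVneq y 0.
  by exists Q => // i /i2l[->|/Qw//].
have xy_gt0 : 0 < x ^+ 2 + y ^+ 2 by rewrite ltr_wpDl ?sqr_ge0// exprn_even_gt0.
pose h := Num.sqrt (x ^+ 2 + y ^+ 2).
have h0 : h != 0 by rewrite gt_eqF// sqrtr_gt0.
have hE : h ^+ 2 = x ^+ 2 + y ^+ 2 by rewrite sqr_sqrtr// ltW.
(* Chosen so that the new entry s x + c y at [i2] is zero. *)
pose c := x / h; pose s := - y / h.
have s0 : s != 0 by rewrite mulf_neq0 ?invr_eq0 ?oppr_eq0.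
have cs : c ^+ 2 + s ^+ 2 = 1.
  by rewrite /c /s !exprMn sqrrN -mulrDl -hE -exprMn divff// expr1n.
have i02 : 0 != i2 by [].
exists (givens 0 i2 c s *m Q).
  split=> [|b M0 Y gY].
    rewrite trmx_mul mulmxA -[Q^T *m _ *m _]mulmxA givens_orthogonal//.
    by rewrite mulmx1.
  rewrite -mulmxA (_ : (fun t => _) = fun t => givens 0 i2 c s *m (Q *m Y t)).
    exact/gaussian_mx_givens/gQ.
  by apply/funext => t; rewrite mulmxA.
move=> i il; rewrite -mulmxA givens_mulmxE /rotate_pair.
have -> : (i == 0) = false by case: i il => [[|i] ?].
have [_|ii2] := eqVneq i i2; last by have [/eqP/(negP ii2)|/Qw] := i2l i il.
by rewrite -/x -/y /c /s; field.
Qed.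

End gaussian_matrices.

(** * Measurability of matrix operations *)

Section measurable_matrices.
Context {d : measure_display} {T : measurableType d} {R : realType}.

Definition measurable_mx {a b : nat} (A : T -> 'M[R]_(a, b)) : Prop :=
  forall i j, measurable_fun setT (fun t => A t i j).

Lemma measurable_mulmx a b c (A : T -> 'M[R]_(a, b)) (B : T -> 'M[R]_(b, c)) :
  measurable_mx A -> measurable_mx B -> measurable_mx (fun t => A t *m B t).
Proof.
move=> mA mB i j; under eq_fun do rewrite mxE.
by apply: measurable_sum => k; exact: measurable_funM.
Qed.

Lemma measurable_cst_mx a b (A : 'M[R]_(a, b)) : measurable_mx (cst A).
Proof. by move=> i j; exact: measurable_cst. Qed.

Lemma measurable_mxsub a b a' b' (f : 'I_a' -> 'I_a) (g : 'I_b' -> 'I_b)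
    (A : T -> 'M[R]_(a, b)) :
  measurable_mx A -> measurable_mx (fun t => mxsub f g (A t)).
Proof. by move=> mA i j; under eq_fun do rewrite mxE; exact: mA. Qed.

Lemma measurable_trmx a b (A : T -> 'M[R]_(a, b)) :
  measurable_mx A -> measurable_mx (fun t => (A t)^T).
Proof. by move=> mA i j; under eq_fun do rewrite mxE; exact: mA. Qed.

Lemma measurable_det n (A : T -> 'M[R]_n) :
  measurable_mx A -> measurable_fun setT (fun t => \det (A t)).
Proof.
move=> mA; apply: measurable_sum => s; apply: measurable_funM => //.
by apply: measurable_prod => i _; exact: mA.
Qed.

Lemma measurable_adjugate n (A : T -> 'M[R]_n) :
  measurable_mx A -> measurable_mx (fun t => \adj (A t)).
Proof.
move=> mA i j; under eq_fun do rewrite mxE.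
apply: measurable_funM => //; apply: measurable_det => k l.
by under eq_fun do rewrite !mxE; exact: mA.
Qed.

Lemma measurable_l2norm n (x : T -> 'cV[R]_n) :
  measurable_mx x -> measurable_fun setT (fun t => l2norm (x t)).
Proof.
move=> mx; apply: (@measurableT_comp _ _ _ _ _ _ (@Num.sqrt R)).
  by apply: continuous_measurable_fun; exact: sqrt_continuous.
by apply: measurable_sum => i; apply: measurable_funX; exact: mx.
Qed.

Lemma measurable_setle (f g : T -> R) :
  measurable_fun setT f -> measurable_fun setT g ->
  measurable [set t | f t <= g t].
Proof. by move=> mf mg; rewrite -[X in measurable X]setTI; exact: measurable_fun_le. Qed.

Lemma measurable_seteq (f g : T -> R) :
  measurable_fun setT f -> measurable_fun setT g ->
  measurable [set t | f t = g t].
Proof.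
move=> mf mg.
rewrite (_ : [set t | _] = [set t | f t <= g t] `&` [set t | g t <= f t]).
  by apply: measurableI; exact: measurable_setle.
by apply/seteqP; split=> t /=; [move=> ->|move=> [? ?]; apply/le_anti/andP].
Qed.

End measurable_matrices.

(** * Decoupling *)

Section decoupling.
Context {d : measure_display} {T : measurableType d} {R : realType}.
Variable P : probability T R.
Local Notation mR := (measurableTypeR R).
Local Open Scope ereal_scope.
Context {I : finType} (mu : I -> R) (r : R) (X : I -> T -> mR).
Hypothesis gX : gaussian_family P mu r X.

Definition boxes (J : pred I) : set (set T) :=
  [set S | exists2 A : I -> set mR, (forall i, measurable (A i)) &
    S = [set t | forall i, J i -> A i (X i t)]].

(** The same sample space with the sigma-algebra generated by the coordinates in [J]: measurability
    for it expresses dependence on these coordinates only. *)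
Definition coordinate_space (J : pred I) := g_sigma_algebraType (boxes J).

Let mX : forall i, measurable_fun setT (X i) := gX.1.

Lemma boxE (J : pred I) (A : I -> set mR) :
  [set t | forall i, J i -> A i (X i t)] =
  [set t | forall i, (if J i then A i else setT) (X i t)].
Proof.
by apply/seteqP; split=> t H i; have := H i; case: ifP => // _; apply.
Qed.

Let mif (J : pred I) (A : I -> set mR) :
  (forall i, measurable (A i)) -> forall i, measurable (if J i then A i else setT).
Proof. by move=> mA i; case: ifP. Qed.

Lemma measurable_box (J : pred I) S : boxes J S -> measurable S.
Proof.
by move=> [A mA ->]; rewrite boxE; exact: (measurable_forall_fin mX (mif J mA)).
Qed.

Lemma boxes_setI_closed (J : pred I) : setI_closed (boxes J).
Proof.
move=> _ _ [A mA ->] [B mB ->]; exists (fun i => A i `&` B i).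
  by move=> i; exact: measurableI.
apply/seteqP; split=> t; first by move=> [HA HB] i Ji; split; [exact: HA|exact: HB].
by move=> H; split=> i /H[].
Qed.

Lemma boxes_setT (J : pred I) : boxes J setT.
Proof. by exists (fun=> setT) => //; apply/seteqP; split. Qed.

Lemma measurable_coordinate_space (J : pred I) (S : set T) :
  measurable (S : set (coordinate_space J)) -> measurable S.
Proof.
have : <<s boxes J >> `<=` (@measurable _ T).
  apply: smallest_sub; first exact: sigma_algebra_measurable.
  by move=> B; exact: measurable_box.
exact.
Qed.

Lemma measurable_coordinate (J : pred I) i : J i ->
  measurable_fun setT (X i : coordinate_space J -> mR).
Proof.
move=> Ji _ A mA; rewrite setTI; apply: sub_sigma_algebra.
exists (fun j => if j == i then A else setT); first by move=> j; case: ifP.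
apply/seteqP; split=> [t At j _|t /(_ i Ji)]; last by rewrite eqxx.
by case: eqVneq => // ->.
Qed.

Lemma boxes_independent (J K : pred I) SJ SK : (forall i, ~~ (J i && K i)) ->
  boxes J SJ -> boxes K SK -> P (SJ `&` SK) = P SJ * P SK.
Proof.
move=> JK [A mA ->] [B mB ->].
rewrite !boxE (gX.2 _ (mif J mA)) (gX.2 _ (mif K mB)) -big_split/=.
pose C i := (if J i then A i else setT) `&` (if K i then B i else setT).
transitivity (P [set t | forall i, C i (X i t)]).
  congr (P _); apply/seteqP; split=> t; first by move=> [HA HB] i;
    split; [exact: HA|exact: HB].
  by move=> H; split=> i; have [] := H i.
rewrite gX.2; last by move=> i; apply: measurableI; exact: mif.
apply: eq_bigr => i _; rewrite /C; have := JK i.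
by case: (J i); case: (K i) => // _;
  rewrite ?setIT ?setTI !probability_setT ?mule1 ?mul1e.
Qed.

(** Boxes are stable under intersection, so two finite measures of equal mass that agree on them
    agree on the generated sigma-algebra. This is applied twice: [step] replaces boxes by arbitrary
    events in one factor while the other factor is fixed. *)
Lemma coordinate_spaces_independent (J K : pred I) SJ SK :
  (forall i, ~~ (J i && K i)) ->
  measurable (SJ : set (coordinate_space J)) ->
  measurable (SK : set (coordinate_space K)) ->
  P (SJ `&` SK) = P SJ * P SK.
Proof.
move=> JK mSJ mSK.
have mSJ' := measurable_coordinate_space mSJ.
have mSK' := measurable_coordinate_space mSK.
have Pfin S : measurable S -> (fine (P S))%:E = P S.
  by move=> mS; rewrite fineK// fin_num_measure.
pose nn S := NngNum (fine_ge0 (measure_ge0 P S)).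
have step (L : pred I) S B : measurable S ->
    (forall B, boxes L B -> P (B `&` S) = P S * P B) ->
    measurable (B : set (coordinate_space L)) -> P (B `&` S) = P S * P B.
  move=> mS H mB.
  have -> : P S * P B = mscale (nn S) P B by rewrite /mscale /nn/= fineK// fin_num_measure.
  rewrite -[LHS]/(mrestr P mS B).
  apply: (g_sigma_algebra_measure_unique (boxes L) _ (fun=> setT)) => //.
  - by move=> ?; exact: measurable_box.
  - by move=> ?; exact: boxes_setT.
  - by rewrite bigcup_const.
  - exact: boxes_setI_closed.
  - move=> D bD; rewrite -[RHS]/((fine (P S))%:E * P D) fineK ?fin_num_measure//.
    exact: H.
  - by move=> _; rewrite /= /mrestr ltey_eq fin_num_measure//; exact: measurableI.
rewrite setIC; apply: (step K) => // B bB.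
rewrite setIC muleC; apply: (step J) => //; first exact: measurable_box bB.
by move=> A bA; rewrite muleC; exact: (boxes_independent JK).
Qed.

Lemma measurable_to_coordinate_space (J : pred I) :
  measurable_fun setT (id : T -> coordinate_space J).
Proof. by move=> _ A mA; rewrite setTI; exact: measurable_coordinate_space mA. Qed.

(* The event is read on two independent copies of the sample space, the
   coordinates in [J] on the first one and those in [K] on the second. *)
Lemma gaussian_decoupling (J K : pred I) (E : set (T * T)) (C : \bar R) :
  (forall i, ~~ (J i && K i)) -> 0 <= C ->
  measurable (E : set (coordinate_space J * coordinate_space K)) ->
  (forall t, P [set t' | E (t, t')] <= C) ->
  P [set t | E (t, t)] <= C.
Proof.
move=> JK C0 mE EC.
pose idJ : {mfun T >-> coordinate_space J} :=
  HB.pack (id : T -> coordinate_space J)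
    (isMeasurableFun.Build _ _ _ _ _ (measurable_to_coordinate_space (J := J))).
pose idK : {mfun T >-> coordinate_space K} :=
  HB.pack (id : T -> coordinate_space K)
    (isMeasurableFun.Build _ _ _ _ _ (measurable_to_coordinate_space (J := K))).
pose diag : {mfun T >-> (coordinate_space J * coordinate_space K)%type} :=
  HB.pack (fun t : T => (t, t) : (coordinate_space J * coordinate_space K)%type)
    (isMeasurableFun.Build _ _ _ _ _ (measurable_fun_pair
      (measurable_to_coordinate_space (J := J))
      (measurable_to_coordinate_space (J := K)))).
(* Independence says that the diagonal map has a product law. The probability of [E (t, t)] is
   therefore a double integral whose inner part is at most [C]. *)
have diagE A B : measurable A -> measurable B ->
    distribution P diag (A `*` B) = distribution P idJ A * distribution P idK B.
  by move=> mA mB; exact: (coordinate_spaces_independent JK mA mB).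
have := product_measure_unique diagE mE => /esym DE.
rewrite -[leLHS]/(distribution P diag E) DE /product_measure1.
apply: (@le_trans _ _ (\int[distribution P idJ]_t (cst C t))).
  apply: ge0_le_integral => //.
  - exact: measurable_fun_xsection.
  - by move=> t _; rewrite /= xsectionE; exact: EC.
rewrite integral_cst// -[X in _ * X <= _]/(P setT).
by rewrite probability_setT mule1.
Qed.

End decoupling.

(** * The Euclidean norm *)

Section euclidean_norm.
Context {R : realType}.

Lemma l2norm_ge0 n (x : 'cV[R]_n) : 0 <= l2norm x.
Proof. exact: sqrtr_ge0. Qed.

Lemma sqr_l2norm n (x : 'cV[R]_n) : l2norm x ^+ 2 = \sum_i x i 0 ^+ 2.
Proof. by rewrite sqr_sqrtr// sumr_ge0// => i _; exact: sqr_ge0. Qed.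

Lemma sqr_l2normE n (x : 'cV[R]_n) : l2norm x ^+ 2 = (x^T *m x) 0 0.
Proof. by rewrite sqr_l2norm mxE; apply: eq_bigr => i _; rewrite mxE expr2. Qed.

Lemma l2norm_eq0 n (x : 'cV[R]_n) : (l2norm x == 0) = (x == 0).
Proof.
rewrite -sqrf_eq0 sqr_l2norm psumr_eq0; last by move=> i _; exact: sqr_ge0.
apply/allP/eqP => [x0|-> i _]; last by rewrite mxE expr0n/= eqxx.
apply/colP => i; rewrite mxE; apply/eqP; rewrite -sqrf_eq0.
exact: (implyP (x0 i (mem_index_enum _))).
Qed.

Lemma l2norm0 n : l2norm (0 : 'cV[R]_n) = 0.
Proof. by apply/eqP; rewrite l2norm_eq0. Qed.

Lemma l2norm_gt0 n (x : 'cV[R]_n) : (0 < l2norm x) = (x != 0).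
Proof. by rewrite lt0r l2norm_ge0 andbT l2norm_eq0. Qed.

Lemma l2normZ n (a : R) (x : 'cV[R]_n) : l2norm (a *: x) = `|a| * l2norm x.
Proof.
apply/eqP; rewrite -(@eqrXn2 _ 2)// ?l2norm_ge0 ?mulr_ge0 ?l2norm_ge0//.
rewrite exprMn !sqr_l2norm real_normK ?num_real// mulr_sumr.
by apply/eqP/eq_bigr => i _; rewrite mxE exprMn.
Qed.

Lemma l2norm_normalize n (x : 'cV[R]_n) : x != 0 ->
  l2norm ((l2norm x)^-1 *: x) = 1.
Proof.
move=> x0; rewrite l2normZ ger0_norm ?invr_ge0 ?l2norm_ge0//.
by rewrite mulVf// l2norm_eq0.
Qed.

Lemma l2norm_orthogonal n (Q : 'M[R]_n) (x : 'cV[R]_n) :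
  Q^T *m Q = 1%:M -> l2norm (Q *m x) = l2norm x.
Proof.
move=> QQ; apply/eqP; rewrite -(@eqrXn2 _ 2)// ?l2norm_ge0//.
by rewrite !sqr_l2normE trmx_mul mulmxA -[x^T *m Q^T *m Q]mulmxA QQ mulmx1.
Qed.

Lemma l2norm_delta n (i : 'I_n) : l2norm (delta_mx i 0 : 'cV[R]_n) = 1.
Proof.
apply/eqP; rewrite -(@eqrXn2 _ 2)// ?l2norm_ge0// expr1n sqr_l2norm (bigD1 i)//=.
rewrite big1 ?addr0 ?mxE ?eqxx ?expr1n// => j ji.
by rewrite mxE (negbTE ji) expr0n.
Qed.

Lemma sqr_l2normD n (x y : 'cV[R]_n) :
  l2norm (x + y) ^+ 2 = l2norm x ^+ 2 + 2 * (x^T *m y) 0 0 + l2norm y ^+ 2.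
Proof.
rewrite !sqr_l2norm mxE mulr_sumr -!big_split/=; apply: eq_bigr => i _.
by rewrite !mxE; ring.
Qed.

(** Obtained by expanding the squared norm of |x|^2 y - <x, y> x. *)
Lemma Cauchy_Schwarz n (x y : 'cV[R]_n) :
  `|(x^T *m y) 0 0| <= l2norm x * l2norm y.
Proof.
have [->|x0] := eqVneq x 0.
  by rewrite trmx0 mul0mx mxE normr0 l2norm0 mul0r.
have x_gt0 : 0 < l2norm x ^+ 2 by rewrite exprn_gt0// l2norm_gt0.
pose k := (x^T *m y) 0 0.
have := sqr_ge0 (l2norm (- k *: x + l2norm x ^+ 2 *: y)).
rewrite sqr_l2normD !l2normZ normrN.
have -> : (- k *: x)^T = - k *: x^T by apply/matrixP => i j; rewrite !mxE.
rewrite -scalemxAl -scalemxAr scalerA mxE.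
rewrite -/k !exprMn real_normK ?num_real// real_normK ?num_real// => h.
rewrite -(@ler_pXn2r _ 2)// ?nnegrE ?mulr_ge0 ?l2norm_ge0//.
rewrite real_normK ?num_real// exprMn -(ler_pM2l x_gt0) -subr_ge0.
by apply: le_trans h _; rewrite le_eqVlt; apply/orP; left; apply/eqP; ring.
Qed.

Lemma l2norm_triangle n (x y : 'cV[R]_n) : l2norm (x + y) <= l2norm x + l2norm y.
Proof.
rewrite -(@ler_pXn2r _ 2)// ?nnegrE ?addr_ge0 ?l2norm_ge0//.
have h : 0 <= l2norm x * l2norm y - (x^T *m y) 0 0.
  by rewrite subr_ge0 (le_trans (ler_norm _) (Cauchy_Schwarz _ _)).
rewrite sqr_l2normD -[_ <= _]subr_ge0.
have -> : (l2norm x + l2norm y) ^+ 2 -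
    (l2norm x ^+ 2 + 2 * (x^T *m y) 0 0 + l2norm y ^+ 2) =
  2 * (l2norm x * l2norm y - (x^T *m y) 0 0) by ring.
by rewrite mulr_ge0.
Qed.

End euclidean_norm.

(** * Linear forms in Gaussian variables *)

Section anticoncentration.
Context {d : measure_display} {T : measurableType d} {R : realType}.
Variable P : probability T R.
Local Notation mR := (measurableTypeR R).

(** The density is at most its peak on an interval of length 2 e, wherever the mean lies. *)
Lemma normal_law_ball_le (m r e : R) : r != 0 -> 0 <= e ->
  (normal_law m r [set x | (`|x| <= e)%R] <= (2 * e * normal_peak r)%:E)%E.
Proof.
move=> r0 e0.
have -> : [set x : R | `|x| <= e] = `[- e, e]%classic.
  by apply/seteqP; split=> x; rewrite /= in_itv/= ler_norml.
rewrite -[leLHS]/(\int[lebesgue_measure]_(x in `[(- e)%R, e]) (normal_pdf m r x)%:E)%E.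
apply: (@le_trans _ _ (\int[lebesgue_measure]_(x in `[(- e)%R, e]) (normal_peak r)%:E)%E).
  apply: ge0_le_integral => //.
  - by move=> x _; rewrite lee_fin normal_pdf_ge0.
  - by apply/measurable_EFinP/measurable_funTS; exact: measurable_normal_pdf.
  - by move=> x _; rewrite lee_fin normal_pdf_ub.
rewrite integral_cst//= lebesgue_measure_itv/= lte_fin.
case: ifPn => _; last by rewrite mule0 lee_fin !mulr_ge0// normal_peak_ge0.
by rewrite -EFinD -EFinM lee_fin opprK le_eqVlt; apply/orP; left; apply/eqP; ring.
Qed.

(* Up to its length, the linear form [c] is the first row of a rotation. *)
Lemma gaussian_linear_form n (M0 : 'cV[R]_n.+1) (r : R) (Y : T -> 'cV[R]_n.+1)
    (c : 'cV[R]_n.+1) : r != 0 -> gaussian_mx P M0 r Y ->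
  exists l m (Z : T -> mR),
    [/\ l ^+ 2 = l2norm c ^+ 2, l * m = (c^T *m M0) 0 0,
        measurable_fun setT Z,
        forall A, measurable A -> P (Z @^-1` A) = normal_law m r A &
        forall t, (c^T *m Y t) 0 0 = l * Z t].
Proof.
move=> r0 gY.
have [Q [QQ gQ] [l Qc]] := exists_gaussian_orthogonal P c r0.
have gQY := gQ _ _ _ gY.
have cE (A : 'cV[R]_n.+1) : (c^T *m A) 0 0 = l * (Q *m A) 0 0.
  have -> : c^T *m A = (Q *m c)^T *m (Q *m A).
    by rewrite trmx_mul mulmxA -[c^T *m Q^T *m Q]mulmxA QQ mulmx1.
  rewrite Qc (_ : (l *: delta_mx 0 0)^T = l *: delta_mx 0 0); last first.
    by apply/matrixP => i j; rewrite !mxE andbC.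
  by rewrite -scalemxAl mxE -rowE mxE.
exists l, ((Q *m M0) 0 0), (fun t => (Q *m Y t) 0 0); split => //.
- by rewrite -(l2norm_orthogonal c QQ) Qc l2normZ l2norm_delta mulr1 real_normK ?num_real.
- exact: (gQY.1 (0, 0)).
- by move=> A mA; rewrite -(gaussian_family_marginal (0, 0) gQY mA).
Qed.

Lemma gaussian_linear_form_le n (M0 : 'cV[R]_n.+1) (r : R) (Y : T -> 'cV[R]_n.+1)
    (c : 'cV[R]_n.+1) (e : R) : r != 0 -> gaussian_mx P M0 r Y ->
  c != 0 -> 0 <= e ->
  (P [set t | (`|(c^T *m Y t) 0 0| <= e)%R] <=
   (2 * (e / l2norm c) * normal_peak r)%:E)%E.
Proof.
move=> r0 gY c0 e0.
have [l [m [Z [l2 _ mZ PZ cY]]]] := gaussian_linear_form c r0 gY.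
have lc : `|l| = l2norm c.
  by apply/eqP; rewrite -(@eqrXn2 _ 2)// ?l2norm_ge0// real_normK ?num_real// l2.
have c_gt0 : 0 < l2norm c by rewrite l2norm_gt0.
apply: le_trans (normal_law_ball_le m r0 (divr_ge0 e0 (ltW c_gt0))).
rewrite -PZ; last first.
  by apply: measurable_setle => //; exact: measurableT_comp.
rewrite le_eqVlt; apply/orP; left; apply/eqP; congr (P _).
by apply/seteqP; split=> t; rewrite /= cY normrM lc ler_pdivlMr// mulrC.
Qed.

End anticoncentration.

(** * Inverse of a Gaussian matrix applied to a fixed vector *)

Section fixed_vector.
Context {d : measure_display} {T : measurableType d} {R : realType}.
Variable P : probability T R.
Local Notation mR := (measurableTypeR R).

Lemma gaussian_mx_sub a b a' b' (f : 'I_a' -> 'I_a) (g : 'I_b' -> 'I_b)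
    (M0 : 'M[R]_(a, b)) (r : R) (Y : T -> 'M[R]_(a, b)) :
  injective f -> injective g -> gaussian_mx P M0 r Y ->
  gaussian_mx P (mxsub f g M0) r (fun t => mxsub f g (Y t)).
Proof.
move=> injf injg gY.
have injfg : injective (fun ik : 'I_a' * 'I_b' => (f ik.1, g ik.2)).
  by move=> [i k] [i' k'] [/injf -> /injg ->].
have := gaussian_family_sub injfg gY; rewrite /gaussian_mx.
congr (gaussian_family P _ r _).
  by apply/funext => ik; rewrite mxE.
by apply/funext => ik; apply/funext => t; rewrite mxE.
Qed.

Lemma gaussian_mx_tr a b (M0 : 'M[R]_(a, b)) (r : R) (Y : T -> 'M[R]_(a, b)) :
  gaussian_mx P M0 r Y -> gaussian_mx P M0^T r (fun t => (Y t)^T).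
Proof.
move=> gY.
have injs : injective (fun ik : 'I_b * 'I_a => (ik.2, ik.1)).
  by move=> [i k] [i' k'] [-> ->].
have := gaussian_family_sub injs gY; rewrite /gaussian_mx.
congr (gaussian_family P _ r _).
  by apply/funext => ik; rewrite mxE.
by apply/funext => ik; apply/funext => t; rewrite mxE.
Qed.

Lemma gaussian_mx_measurable a b (M0 : 'M[R]_(a, b)) (r : R) (Y : T -> 'M[R]_(a, b)) :
  gaussian_mx P M0 r Y -> measurable_mx Y.
Proof. by move=> [mY _] i k; exact: (mY (i, k)). Qed.

(* Signed maximal minors, i.e. the first column of the adjugate of a square
   matrix whose rows other than the first one are those of [A]. *)
Definition minors {j : nat} (A : 'M[R]_(j, j.+1)) : 'cV[R]_j.+1 :=
  \col_i ((-1) ^+ i * \det (col' i A)).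

Lemma adjugate_delta0 j (N : 'M[R]_j.+1) :
  \adj N *m (delta_mx 0 0 : 'cV_j.+1) = minors (row' 0 N).
Proof.
rewrite -colE; apply/colP => i; rewrite !mxE /cofactor add0n; congr (_ * \det _).
by apply/matrixP => k l; rewrite !mxE.
Qed.

Lemma det_minors j (N : 'M[R]_j.+1) : \det N = (row 0 N *m minors (row' 0 N)) 0 0.
Proof.
rewrite (expand_det_row _ 0) mxE; apply: eq_bigr => i _.
by rewrite -adjugate_delta0 -colE !mxE.
Qed.

Lemma measurable_minors d' (T' : measurableType d') j (A : T' -> 'M[R]_(j, j.+1)) :
  measurable_mx A -> measurable_mx (fun t => minors (A t)).
Proof.
move=> mA i k; under eq_fun do rewrite mxE.
apply: measurable_funM => //; apply: measurable_det => a b.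
by under eq_fun do rewrite mxE; exact: mA.
Qed.

(** For the vector p of minors, the condition reads |<g, M p>| <= l |p| / tau. Anticoncentration
    divides this threshold by |M p|, and |p| <= K |M p| removes every trace of the rows other than
    the first. *)
Lemma gaussian_delta_bound j m (M : 'M[R]_(m, j.+1)) (K r l tau : R)
    (M0 : 'M[R]_(j.+1, m)) (Y : T -> 'M[R]_(j.+1, m)) :
  r != 0 -> (forall v : 'cV_j.+1, l2norm v <= K * l2norm (M *m v)) ->
  gaussian_mx P M0 r Y -> 0 <= K -> 0 <= l -> 0 < tau ->
  P [set t | minors (row' 0 (Y t) *m M) = 0] = 0%E ->
  (P [set t | (tau * `|\det (Y t *m M)| <=
      l * l2norm (\adj (Y t *m M) *m (delta_mx 0 0 : 'cV_j.+1)))%R] <=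
   (2 * (l * K / tau) * normal_peak r)%:E)%E.
Proof.
(* Without rows M kills every vector, which contradicts [MK] at a unit vector. *)
case: m M M0 Y => [|m] M M0 Y r0 MK gY K0 l0 tau0 p0.
  have := MK (delta_mx 0 0); rewrite l2norm_delta [M]flatmx0 mul0mx l2norm0 mulr0.
  by rewrite ler10.
have mY := gaussian_mx_measurable gY.
pose p t := minors (row' 0 (Y t) *m M).
have mp : measurable_mx p.
  apply: measurable_minors; apply: measurable_mulmx; last exact: measurable_cst_mx.
  by move=> i k; under eq_fun do rewrite mxE; exact: mY.
pose X (ik : 'I_j.+1 * 'I_m.+1) t := Y t ik.1 ik.2.
pose J := [pred ik : 'I_j.+1 * 'I_m.+1 | ik.1 != 0].
pose L := [pred ik : 'I_j.+1 * 'I_m.+1 | ik.1 == 0].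
pose S := (coordinate_space X J * coordinate_space X L)%type.
have mp' : measurable_mx (fun z : S => p z.1).
  apply: measurable_minors; apply: measurable_mulmx; last exact: measurable_cst_mx.
  move=> i k; under eq_fun do rewrite mxE.
  apply: (measurableT_comp (f := fun t : coordinate_space X J => Y t (lift 0 i) k)) => //.
  exact: (@measurable_coordinate _ _ _ _ X J (lift 0 i, k) isT).
have mg : measurable_mx (fun z : S => (row 0 (Y z.2))^T).
  move=> i k; under eq_fun do rewrite !mxE.
  apply: (measurableT_comp (f := fun t : coordinate_space X L => Y t 0 i)) => //.
  exact: (@measurable_coordinate _ _ _ _ X L (0, i) isT).
have mnp : measurable_fun setT (fun z : S => l2norm (p z.1)) by exact: measurable_l2norm.
have mq : measurable_mx (fun z : S => (M *m p z.1)^T *m (row 0 (Y z.2))^T).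
  apply: measurable_mulmx => //; apply: measurable_trmx.
  by apply: measurable_mulmx => //; exact: measurable_cst_mx.
(* The first component of z supplies all rows but the first, the second one the first row. The case
   p = 0 is cut out: there the inequality reads 0 <= 0 and the uniform bound asked by
   [gaussian_decoupling] may fail. *)
pose E := [set z : S | tau * `|((M *m p z.1)^T *m (row 0 (Y z.2))^T) 0 0| <=
   l * l2norm (p z.1)] `&` ~` [set z : S | l2norm (p z.1) = 0].
have mE : measurable E.
  apply: measurableI; last by apply: measurableC; exact: measurable_seteq.
  apply: measurable_setle; apply: measurable_funM => //.
  exact: measurableT_comp (mq 0 0).
have mdet : measurable [set t | (tau * `|\det (Y t *m M)| <=
      l * l2norm (\adj (Y t *m M) *m (delta_mx 0 0 : 'cV_j.+1)))%R].
  have mN : measurable_mx (fun t => Y t *m M).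
    by apply: measurable_mulmx => //; exact: measurable_cst_mx.
  apply: measurable_setle; apply: measurable_funM => //.
    by apply: measurableT_comp => //; exact: measurable_det.
  apply: measurable_l2norm; apply: measurable_mulmx; last exact: measurable_cst_mx.
  exact: measurable_adjugate.
have mp0 : measurable [set t | p t = 0].
  rewrite (_ : [set t | _] = [set t | l2norm (p t) = 0]).
    by apply: measurable_seteq => //; exact: measurable_l2norm.
  by apply/seteqP; split=> t /= /eqP; [rewrite -l2norm_eq0|rewrite l2norm_eq0] => /eqP.
have mEd : measurable [set t : T | E (t, t)].
  rewrite -[X in measurable X]setTI.
  have mdiag : measurable_fun setT ((fun t => (t, t)) : T -> S).
    apply: measurable_fun_pair; exact: (measurable_to_coordinate_space gY).
  exact: (mdiag measurableT E mE).
have rowE t : row' 0 (Y t *m M) = row' 0 (Y t) *m M.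
  by apply/matrixP => i k; rewrite !mxE; apply: eq_bigr => h _; rewrite mxE.
have quadE t t' : ((M *m p t)^T *m (row 0 (Y t'))^T) 0 0 =
    (row 0 (Y t' *m M) *m p t) 0 0.
  by rewrite -trmx_mul [LHS]mxE row_mul mulmxA.
apply: (@le_trans _ _ (P ([set t : T | E (t, t)] `|` [set t | p t = 0]))).
  apply: le_measure; rewrite ?inE//; first exact: measurableU.
  move=> t /=; rewrite adjugate_delta0 det_minors rowE -/(p t) -quadE => h.
  have [p0t|p0t] := eqVneq (p t) 0; [by right|left].
  by split=> //= /eqP; rewrite l2norm_eq0 (negbTE p0t).
apply: (@le_trans _ _ (P [set t : T | E (t, t)] + P [set t | (p t = 0)%R])%E).
  exact: measureU2.
rewrite p0 adde0.
apply: (gaussian_decoupling gY (J := J) (K := L)) => //.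
- by move=> ik; rewrite /= andbC; case: eqP.
- by rewrite lee_fin !mulr_ge0 ?normal_peak_ge0// invr_ge0 ltW.
move=> t; have [p0t|p0t] := eqVneq (p t) 0.
  rewrite (_ : [set t' | _] = set0) ?measure0.
    by rewrite lee_fin !mulr_ge0 ?normal_peak_ge0// invr_ge0 ltW.
  by apply/seteqP; split=> t' //= [_ /=]; rewrite p0t l2norm0.
have Mp0 : M *m p t != 0.
  apply: contra p0t => /eqP Mp0; rewrite -l2norm_eq0 eq_le l2norm_ge0 andbT.
  by rewrite (le_trans (MK _))// Mp0 l2norm0 mulr0.
have gg : gaussian_mx P (row 0 M0)^T r (fun t' => (row 0 (Y t'))^T).
  apply: gaussian_mx_tr; have inj0 : injective (fun _ : 'I_1 => 0 : 'I_j.+1).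
    by move=> ? ? _; rewrite !ord1.
  have := gaussian_mx_sub inj0 (@inj_id _) gY; rewrite /gaussian_mx.
  by congr (gaussian_family P _ r _).
have e0 : 0 <= l * l2norm (p t) / tau by rewrite !mulr_ge0 ?l2norm_ge0// invr_ge0 ltW.
apply: le_trans (_ : (P [set t' | (`|((M *m p t)^T *m (row 0 (Y t'))^T) 0 0| <=
    l * l2norm (p t) / tau)%R] <= _)%E).
  apply: le_measure; rewrite ?inE.
  - rewrite -[X in measurable X]setTI.
    have mpair : measurable_fun setT ((fun t' => (t, t')) : T -> S).
      apply: measurable_fun_pair; first exact: measurable_cst.
      exact: (measurable_to_coordinate_space gY).
    exact: (mpair measurableT E mE).
  - apply: measurable_setle => //; apply: measurableT_comp => //.
    have mgg := gaussian_mx_measurable gg.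
    exact: (measurable_mulmx (measurable_cst_mx (M *m p t)^T) mgg).
  - by move=> t' [/= h _]; rewrite ler_pdivlMr// mulrC.
apply: le_trans (gaussian_linear_form_le r0 gg Mp0 e0) _.
rewrite lee_fin ler_wpM2r ?normal_peak_ge0// ler_pM2l//.
rewrite ler_pdivrMr ?l2norm_gt0//.
rewrite [leLHS](_ : _ = l * tau^-1 * l2norm (p t)); last by ring.
rewrite [leRHS](_ : _ = l * tau^-1 * (K * l2norm (M *m p t))); last by ring.
by rewrite ler_wpM2l// mulr_ge0// invr_ge0 ltW.
Qed.

(** The first signed minor is the determinant of the same problem with the first row of Y and the
    first column of M deleted, so by induction the vector of minors is almost surely nonzero. Since
    det N = 0 implies the event of [gaussian_delta_bound] for every tau, large values of tau force
    probability zero. *)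
Lemma gaussian_det_neq0 j m (M : 'M[R]_(m, j)) (K r : R)
    (M0 : 'M[R]_(j, m)) (Y : T -> 'M[R]_(j, m)) :
  r != 0 -> 0 <= K -> (forall v : 'cV_j, l2norm v <= K * l2norm (M *m v)) ->
  gaussian_mx P M0 r Y -> P [set t | \det (Y t *m M) = 0] = 0%E.
Proof.
move=> r0 K0; elim: j => [|j IH] in M M0 Y *; move=> MK gY.
  rewrite (_ : [set t | _] = set0) ?measure0//; apply/seteqP; split=> t //=.
  by move/eqP; rewrite det_mx00 oner_eq0.
have mY := gaussian_mx_measurable gY.
have mN : measurable_mx (fun t => Y t *m M).
  by apply: measurable_mulmx => //; exact: measurable_cst_mx.
pose Y' t := row' 0 (Y t).
have gY' : gaussian_mx P (row' 0 M0) r Y'.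
  have := gaussian_mx_sub (@lift_inj _ 0) (@inj_id _) gY; rewrite /gaussian_mx.
  by congr (gaussian_family P _ r _).
have mY' := gaussian_mx_measurable gY'.
have M'K (v : 'cV_j) : l2norm v <= K * l2norm (col' 0 M *m v).
  (* Padding v by a leading zero preserves its norm, so M without its first column keeps the
     constant K. *)
  pose w : 'cV[R]_j.+1 := \col_i if unlift 0 i is Some k then v k 0 else 0.
  have wv : l2norm w = l2norm v.
    apply/eqP; rewrite -(@eqrXn2 _ 2)// ?l2norm_ge0// !sqr_l2norm big_ord_recl.
    rewrite mxE unlift_none expr0n add0r; apply/eqP/eq_bigr => i _.
    by rewrite mxE liftK.
  have -> : col' 0 M *m v = M *m w.
    apply/colP => i; rewrite !mxE big_ord_recl mxE unlift_none mulr0 add0r.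
    by apply: eq_bigr => k _; rewrite !mxE liftK.
  by rewrite -wv; exact: MK.
have minors0 : P [set t | minors (Y' t *m M) = 0] = 0%E.
  apply/eqP; rewrite eq_le measure_ge0 andbT -(IH _ _ _ M'K gY').
  have mA : measurable_mx (fun t => Y' t *m M).
    by apply: measurable_mulmx => //; exact: measurable_cst_mx.
  apply: le_measure; rewrite ?inE.
  - rewrite (_ : [set t | _] = [set t | l2norm (minors (Y' t *m M)) = 0]).
      by apply: measurable_seteq => //; apply: measurable_l2norm; exact: measurable_minors.
    by apply/seteqP; split=> t /= /eqP; [rewrite -l2norm_eq0|rewrite l2norm_eq0] => /eqP.
  - apply: measurable_seteq => //; apply: measurable_det.
    by apply: measurable_mulmx => //; exact: measurable_cst_mx.
  - move=> t /= /colP/(_ 0); rewrite !mxE expr0 mul1r => <-; congr (\det _).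
    by apply/matrixP => i k; rewrite !mxE; apply: eq_bigr => h _; rewrite [col' 0 M _ _]mxE.
set A := [set t | _].
have mA : measurable A by apply: measurable_seteq => //; exact: measurable_det.
have PA_fin : P A \is a fin_num by exact: fin_num_measure.
pose c := 2 * K * normal_peak r.
have PA_le tau : 0 < tau -> fine (P A) <= c / tau.
  move=> tau0; rewrite -lee_fin fineK//.
  have -> : c / tau = 2 * (1 * K / tau) * normal_peak r by rewrite /c; ring.
  apply: le_trans (gaussian_delta_bound r0 MK gY K0 ler01 tau0 minors0).
  apply: le_measure; rewrite ?inE//.
    apply: measurable_setle; apply: measurable_funM => //.
      by apply: measurableT_comp => //; exact: measurable_det.
    apply: measurable_l2norm; apply: measurable_mulmx; last exact: measurable_cst_mx.
    exact: measurable_adjugate.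
  by move=> t /= ->; rewrite normr0 mulr0 mulr_ge0// l2norm_ge0.
have c0 : 0 <= c by rewrite !mulr_ge0// normal_peak_ge0.
rewrite -(fineK PA_fin); congr EFin; apply/eqP; apply/negP => /negP PA0.
have PA_gt0 : 0 < fine (P A) by rewrite lt0r PA0 fine_ge0.
have c1 : 0 < 2 * c + 1 by lra.
(* With tau = (2 c + 1) / P(A) the bound would give 2 c + 1 <= c, although c >= 0. *)
have := PA_le _ (divr_gt0 c1 PA_gt0).
by rewrite invf_div mulrA ler_pdivlMr// mulrC ler_pM2r//; lra.
Qed.

End fixed_vector.

(** * Inverse of a Gaussian matrix applied to an arbitrary vector *)

Section arbitrary_vector.
Context {d : measure_display} {T : measurableType d} {R : realType}.
Variable P : probability T R.

Lemma normr_det_orthogonal n (Q : 'M[R]_n) : Q^T *m Q = 1%:M -> `|\det Q| = 1.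
Proof.
move=> QQ; apply/eqP; rewrite -(@eqrXn2 _ 2)// expr1n real_normK ?num_real//.
by rewrite expr2 -{1}det_tr -det_mulmx QQ det1.
Qed.

Lemma gaussian_det_adj_bound j m (M : 'M[R]_(m, j.+1)) (K r tau : R)
    (M0 : 'M[R]_(j.+1, m)) (Y : T -> 'M[R]_(j.+1, m)) (w : 'cV[R]_j.+1) :
  r != 0 -> 0 <= K -> (forall v : 'cV_j.+1, l2norm v <= K * l2norm (M *m v)) ->
  gaussian_mx P M0 r Y -> 0 < tau ->
  (P [set t | (tau * `|\det (Y t *m M)| <= l2norm (\adj (Y t *m M) *m w))%R] <=
   (2 * (l2norm w * K / tau) * normal_peak r)%:E)%E.
Proof.
move=> r0 K0 MK gY tau0.
have [Q [QQ gQ] [l Qw]] := exists_gaussian_orthogonal P w r0.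
have lw : `|l| = l2norm w.
  by rewrite -(l2norm_orthogonal w QQ) Qw l2normZ l2norm_delta mulr1.
have gQY := gQ _ _ _ gY.
have minors0 : P [set t | minors (row' 0 (Q *m Y t) *m M) = 0] = 0%E.
  apply/eqP; rewrite eq_le measure_ge0 andbT -(gaussian_det_neq0 r0 K0 MK gQY).
  have mQY := gaussian_mx_measurable gQY.
  have mrow : measurable_mx (fun t => row' 0 (Q *m Y t)).
    by move=> i k; under eq_fun do rewrite mxE; exact: mQY.
  have mA : measurable_mx (fun t => row' 0 (Q *m Y t) *m M).
    by apply: measurable_mulmx => //; exact: measurable_cst_mx.
  apply: le_measure; rewrite ?inE.
  - rewrite (_ : [set t | _] = [set t | l2norm (minors (row' 0 (Q *m Y t) *m M)) = 0]).
      by apply: measurable_seteq => //; apply: measurable_l2norm; exact: measurable_minors.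
    by apply/seteqP; split=> t /= /eqP; [rewrite -l2norm_eq0|rewrite l2norm_eq0] => /eqP.
  - apply: measurable_seteq => //; apply: measurable_det.
    by apply: measurable_mulmx => //; exact: measurable_cst_mx.
  - move=> t /= p0; rewrite det_minors (_ : row' 0 _ = row' 0 (Q *m Y t) *m M).
      by rewrite p0 mulmx0 mxE.
    by apply/matrixP => i k; rewrite !mxE; apply: eq_bigr => h _; rewrite [in RHS]mxE.
have := gaussian_delta_bound r0 MK gQY K0 (normr_ge0 l) tau0 minors0.
rewrite lw; apply: le_trans; rewrite le_eqVlt; apply/orP; left; apply/eqP.
congr (P _); apply/seteqP; rewrite /= -lw.
(* With N = Y M, the identity adj(Q N) Q = det(Q) adj(N) is checked by cancelling an invertible N on
   the right, and |det Q| = 1. If det N = 0, both events hold since their left sides vanish. *)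
suff adjE t : \det (Y t *m M) != 0 ->
    `|l| * l2norm (\adj (Q *m Y t *m M) *m (delta_mx 0 0 : 'cV_j.+1)) =
    l2norm (\adj (Y t *m M) *m w).
  have detE t : `|\det (Q *m Y t *m M)| = `|\det (Y t *m M)|.
    by rewrite -mulmxA det_mulmx normrM (normr_det_orthogonal QQ) mul1r.
  by split=> t /=; rewrite detE; (have [-> _|/adjE ->//] := eqVneq (\det (Y t *m M)) 0;
    rewrite normr0 mulr0 ?mulr_ge0 ?l2norm_ge0).
set N := Y t *m M => N0.
rewrite -l2normZ scalemxAr -Qw.
have -> : \adj (Q *m Y t *m M) *m (Q *m w) = \det Q *: (\adj N *m w).
  rewrite mulmxA scalemxAl; congr (_ *m w).
  have uN : N \in unitmx by rewrite unitmxE unitfE.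
  apply: (can_inj (mulmxK uN)); rewrite -scalemxAl mul_adj_mx.
  rewrite -[LHS]mulmxA /N [Q *m (Y t *m M)]mulmxA mul_adj_mx -mulmxA det_mulmx.
  by rewrite scale_scalar_mx.
by rewrite l2normZ (normr_det_orthogonal QQ) mul1r.
Qed.

End arbitrary_vector.

(** * Numerical bounds *)

Section numerical_bounds.
Context {R : realType}.

(** By the mean value theorem, f - p does not decrease on the half-line. Repeated use integrates a
    polynomial bound and raises its degree by one each time. *)
Lemma le_of_derive (f df : R -> R) (p : {poly R}) :
  (forall x : R, is_derive x 1 f (df x)) -> p.[0] <= f 0 ->
  (forall x, 0 <= x -> (deriv p).[x] <= df x) -> forall x, 0 <= x -> p.[x] <= f x.
Proof.
move=> fdf p0 pdf x; rewrite le_eqVlt => /predU1P[<-//|x0].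
pose g y := f y - p.[y].
have gdg (y : R) : is_derive y 1 g (df y - (deriv p).[y]).
  exact: is_deriveB.
have cg : {within `[0, x], continuous g}.
  apply: continuous_subspaceT => y.
  exact/differentiable_continuous/derivable1_diffP/ex_derive.
have [c c0x gE] := MVT x0 (fun y _ => gdg y) cg.
rewrite -subr_ge0 -/(g x) -(subrK (g 0) (g x)) gE subr0.
rewrite addr_ge0 ?subr_ge0// mulr_ge0 ?(ltW x0)// subr_ge0 pdf//.
by move: c0x; rewrite in_itv/= => /andP[/ltW].
Qed.

Lemma ge_of_derive (f df : R -> R) (p : {poly R}) :
  (forall x : R, is_derive x 1 f (df x)) -> f 0 <= p.[0] ->
  (forall x, 0 <= x -> df x <= (deriv p).[x]) -> forall x, 0 <= x -> f x <= p.[x].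
Proof.
move=> fdf p0 pdf x x0; rewrite -lerN2 -hornerN.
apply: (@le_of_derive (fun y => - f y) (fun y => - df y)) => // [|y y0].
- by rewrite hornerN lerN2.
- by rewrite derivN hornerN lerN2 pdf.
Qed.

(** Starting from cos <= 1, each bound integrates the preceding one, alternating between sin and cos
    and between upper and lower bounds. *)
Lemma cos_ge_taylor (x : R) : 0 <= x ->
  1 - x ^+ 2 / 2 + x ^+ 4 / 24 - x ^+ 6 / 720 <= cos x.
Proof.
have dcos (y : R) : is_derive y 1 cos (- sin y) by exact: is_derive_cos.
have dsin (y : R) : is_derive y 1 sin (cos y) by exact: is_derive_sin.
pose E := ((derivXn, derivZ, derivB, derivD, derivN, derivC, derivX),
  (hornerD, hornerN, hornerX, hornerC, hornerXn, hornerZ, hornerMn, horner0)).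
have s1 y : 0 <= y -> sin y <= ('X : {poly R}).[y].
  by apply: (ge_of_derive dsin) => [|z z0]; rewrite ?sin0 !E ?cos_le1.
have c2 y : 0 <= y -> (1%:P - 2^-1 *: 'X^2 : {poly R}).[y] <= cos y.
  apply: (le_of_derive dcos) => [|z z0]; rewrite ?cos0 !E; first by lra.
  by have := s1 z z0; rewrite !E/=; lra.
have s3 y : 0 <= y -> ('X - 6^-1 *: 'X^3 : {poly R}).[y] <= sin y.
  apply: (le_of_derive dsin) => [|z z0]; rewrite ?sin0 !E; first by lra.
  by have := c2 z z0; rewrite !E/=; lra.
have c4 y : 0 <= y -> cos y <= (1%:P - 2^-1 *: 'X^2 + 24^-1 *: 'X^4 : {poly R}).[y].
  apply: (ge_of_derive dcos) => [|z z0]; rewrite ?cos0 !E; first by lra.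
  by have := s3 z z0; rewrite !E/=; lra.
have s5 y : 0 <= y -> sin y <= ('X - 6^-1 *: 'X^3 + 120^-1 *: 'X^5 : {poly R}).[y].
  apply: (ge_of_derive dsin) => [|z z0]; rewrite ?sin0 !E; first by lra.
  by have := c4 z z0; rewrite !E/=; lra.
have c6 y : 0 <= y ->
    (1%:P - 2^-1 *: 'X^2 + 24^-1 *: 'X^4 - 720^-1 *: 'X^6 : {poly R}).[y] <= cos y.
  apply: (le_of_derive dcos) => [|z z0]; rewrite ?cos0 !E; first by lra.
  by have := s5 z z0; rewrite !E/=; lra.
by move=> x0; have := c6 x x0; rewrite !E; lra.
Qed.

(** The Taylor polynomial of degree 6 is still positive at 113/72, while cos decreases up to its
    zero pi/2. The fraction is close enough to pi/2 for the bound 233/93 on sqrt(2 pi) needed in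
    [normal_law_tail34_ge]. *)
Lemma pi_half_gt : 113 / 72 < pi / 2 :> R.
Proof.
have cos_gt0 : 0 < cos (113 / 72 : R).
  by apply: lt_le_trans (cos_ge_taylor _); lra.
rewrite ltNge; apply/negP; rewrite le_eqVlt => /predU1P[pE|p_lt].
  by move: cos_gt0; rewrite -pE cos_pihalf ltxx.
have : cos (113 / 72 : R) < cos (pi / 2).
  by clear cos_gt0; rewrite ltr_cos// in_itv/=; have := pi_ge2 R; lra.
by rewrite cos_pihalf ltNge (ltW cos_gt0).
Qed.

Lemma expRN_le_taylor (x : R) : 0 <= x ->
  expR (- x) <= 1 - x + x ^+ 2 / 2 - x ^+ 3 / 6 + x ^+ 4 / 24.
Proof.
have dexp (y : R) : is_derive y 1 (fun z => expR (- z)) (- expR (- y)).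
  have := @is_derive1_comp R expR -%R y _ _ (is_derive_expR (- y)) (is_deriveNid y 1).
  by rewrite mulrN1.
pose E := ((derivXn, derivZ, derivB, derivD, derivN, derivC, derivX),
  (hornerD, hornerN, hornerX, hornerC, hornerXn, hornerZ, hornerMn, horner0)).
have e0 : expR (- 0) = 1 :> R by rewrite oppr0 expR0.
have e1 y : 0 <= y -> (1%:P - 'X : {poly R}).[y] <= expR (- y).
  by move=> _; rewrite !E; exact: expR_ge1Dx.
have e2 y : 0 <= y -> expR (- y) <= (1%:P - 'X + 2^-1 *: 'X^2 : {poly R}).[y].
  apply: (ge_of_derive dexp) => [|z z0]; rewrite ?e0 !E; first by lra.
  by have := e1 z z0; rewrite !E/=; lra.
have e3 y : 0 <= y -> (1%:P - 'X + 2^-1 *: 'X^2 - 6^-1 *: 'X^3 : {poly R}).[y] <= expR (- y).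
  apply: (le_of_derive dexp) => [|z z0]; rewrite ?e0 !E; first by lra.
  by have := e2 z z0; rewrite !E/=; lra.
have e4 y : 0 <= y ->
    expR (- y) <= (1%:P - 'X + 2^-1 *: 'X^2 - 6^-1 *: 'X^3 + 24^-1 *: 'X^4 : {poly R}).[y].
  apply: (ge_of_derive dexp) => [|z z0]; rewrite ?e0 !E; first by lra.
  by have := e3 z z0; rewrite !E/=; lra.
by move=> x0; have := e4 x x0; rewrite !E; lra.
Qed.

End numerical_bounds.

(** * Moments and tails of the normal law *)

Section normal_moments.
Context {R : realType}.
Local Notation leb := (@lebesgue_measure R).
Local Notation mR := (measurableTypeR R).

Lemma normal_peakE (r : R) : 0 < r -> r * normal_peak r = (Num.sqrt (2 * pi))^-1.
Proof.
move=> r0; rewrite /normal_peak -mulrnAr sqrtrM ?sqr_ge0// sqrtr_sqr gtr0_norm//.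
by rewrite invfM mulrA divff ?gt_eqF// mul1r mulr_natl.
Qed.

Let mpdf (m r : R) : measurable_fun setT (fun x : mR => (normal_pdf m r x)%:E).
Proof. by apply/measurable_EFinP; exact: measurable_normal_pdf. Qed.

Let pdf_ge0 (m r x : R) : (0 <= (normal_pdf m r x)%:E)%E.
Proof. by rewrite lee_fin normal_pdf_ge0. Qed.

(* Comparison with the density of standard deviation [s * r], letting
   [s] tend to 1; the key is [1 + u <= expR u]. *)
Lemma normal_variance_le (m r : R) : 0 < r ->
  (\int[normal_law m r]_x ((x - m) ^+ 2)%:E <= (r ^+ 2)%:E)%E.
Proof.
move=> r0; have r_neq0 : r != 0 by rewrite gt_eqF.
have msq : measurable_fun setT (fun x : mR => ((x - m) ^+ 2)%:E).
  by apply/measurable_EFinP; apply: measurable_funX; exact: measurable_funB.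
have sq0 (x : R) : (0 <= ((x - m) ^+ 2)%:E)%E by rewrite lee_fin sqr_ge0.
rewrite integral_normal_law//; set I := (X in (X <= _)%E).
have I0 : (0 <= I)%E by apply: integral_ge0 => x _; rewrite mule_ge0.
have key s : 1 < s -> (I <= (r ^+ 2 * s ^+ 2)%:E)%E.
  move=> s1; have s0 : 0 < s by rewrite (lt_trans _ s1).
  have sr0 : s * r != 0 by rewrite mulf_neq0// gt_eqF.
  (* The ratio of the exponentials for the standard deviations s r and r is
     [expR (c * (x - m) ^+ 2)]. Bounding it below by 1 + c (x - m)^2 and integrating gives 1 + c I
     <= s. *)
  pose c := (1 - s ^- 2) / (r ^+ 2 *+ 2).
  have c0 : 0 < c.
    rewrite divr_gt0// ?pmulrn_lgt0 ?exprn_gt0// subr_gt0.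
    by rewrite invf_lt1 ?exprn_gt0// exprn_egt1.
  have le_pdf x : normal_pdf m r x + c * ((x - m) ^+ 2 * normal_pdf m r x) <=
      s * normal_pdf m (s * r) x.
    rewrite !normal_pdfE//.
    have -> : normal_peak (s * r) = normal_peak r / s.
      have p1 := normal_peakE r0; have p2 := normal_peakE (mulr_gt0 s0 r0).
      by apply: (mulfI sr0); rewrite p2 -p1; field; rewrite gt_eqF.
    rewrite [leRHS](_ : _ = normal_peak r * normal_fun m (s * r) x); last first.
      by field; rewrite gt_eqF.
    have -> : normal_fun m (s * r) x = normal_fun m r x * expR (c * (x - m) ^+ 2).
      rewrite /normal_fun -expRD; congr expR; rewrite /c.
      by field; rewrite r_neq0 gt_eqF.
    rewrite [leRHS]mulrA [leLHS](_ : _ =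
      normal_peak r * normal_fun m r x * (1 + c * (x - m) ^+ 2)); last by ring.
    apply: ler_wpM2l; last exact: expR_ge1Dx.
    by rewrite mulr_ge0 ?normal_peak_ge0 ?normal_fun_ge0.
  have : (1 + c%:E * I <= s%:E)%E.
    rewrite -(integral_normal_pdf m r) /I -ge0_integralZl//; last 3 first.
    - exact: emeasurable_funM.
    - by move=> x _; rewrite mule_ge0.
    - by rewrite lee_fin ltW.
    rewrite -ge0_integralD//; last 2 first.
    - by move=> x _; rewrite !mule_ge0// lee_fin ltW.
    - by apply: emeasurable_funM => //; exact: emeasurable_funM.
    rewrite -[leRHS]mule1 -(integral_normal_pdf m (s * r)).
    rewrite -[leRHS]ge0_integralZl//; last by rewrite lee_fin ltW.
    apply: ge0_le_integral => //.
    - by move=> x _; rewrite adde_ge0// !mule_ge0// lee_fin ltW.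
    - apply: emeasurable_funD => //.
      by apply: emeasurable_funM => //; exact: emeasurable_funM.
    - exact: emeasurable_funM.
    - by move=> x _; rewrite -!EFinM -EFinD lee_fin le_pdf.
  move: I I0 => [v| |]//; last by rewrite gt0_muley ?lte_fin// addey.
  rewrite -EFinM -EFinD !lee_fin => v0 h.
  have : c * v <= s - 1 by lra.
  rewrite mulrC -ler_pdivlMr// => /le_trans; apply.
  have -> : (s - 1) / c = r ^+ 2 * s ^+ 2 * (2 / (s + 1)).
    rewrite /c; field.
    by rewrite r_neq0 !gt_eqF// ?subr_gt0 ?exprn_egt1// addr_gt0.
  apply: ler_piMr; first by rewrite mulr_ge0 ?sqr_ge0.
  by rewrite ler_pdivrMr ?addr_gt0//; lra.
apply/lee_addgt0Pr => e e0; have q0 : 0 < 1 + e / r ^+ 2.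
  by rewrite addr_gt0// divr_gt0// exprn_gt0.
(* For this s the bound r^2 s^2 equals r^2 + e. *)
have := key (Num.sqrt (1 + e / r ^+ 2)).
rewrite sqr_sqrtr ?(ltW q0)// mulrDr mulr1 mulrCA divff ?gt_eqF ?exprn_gt0// mulr1.
by apply; rewrite -[ltLHS]sqrtr1 ltr_sqrt// ltrDl divr_gt0// exprn_gt0.
Qed.

(** Antiderivative of the degree 4 Taylor polynomial of exp(-u) taken at u = x^2 / 2, which bounds
    exp(-x^2 / 2) from above. *)
Let S : {poly R} := 'X - 6^-1 *: 'X^3 + 40^-1 *: 'X^5 - 336^-1 *: 'X^7 +
  3456^-1 *: 'X^9.

(** After the substitution of r u + m for the variable, the density is [normal_peak r] times
    exp(-u^2 / 2), which is at most the derivative of [S]; and [S] is odd. *)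
Lemma normal_law_ball34_le (m r : R) : 0 < r ->
  (normal_law m r [set x | (`|x - m| < 3 / 4 * r)%R] <=
   (r * normal_peak r * (2 * S.[3 / 4]))%:E)%E.
Proof.
move=> r0; have r_neq0 : r != 0 by rewrite gt_eqF.
set B := [set x | _].
have mB : measurable (B : set mR).
  rewrite (_ : B = `](m - 3 / 4 * r), (m + 3 / 4 * r)[%classic).
    exact: measurable_itv.
  by apply/seteqP; split=> x; rewrite /B/= in_itv/= ltr_distl.
have mI : measurable_fun setT (fun x : mR => (\1_B x : R)%:E).
  by apply/measurable_EFinP; exact: measurable_indic.
rewrite -(setIT B) -integral_indic// integral_normal_law//.
rewrite (@integral_affine _ r m)//; last 2 first.
- exact: emeasurable_funM.
- by move=> x; rewrite mule_ge0// lee_fin.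
rewrite gtr0_norm//.
have Idef : (\int[leb]_(x in `[(- (3 / 4))%R, (3 / 4)%R]) ((deriv S).[x])%:E =
    (S.[3 / 4])%:E - (S.[- (3 / 4)])%:E)%E.
  apply: continuous_FTC2 => //; first by lra.
  - by apply: continuous_subspaceT; exact: continuous_horner.
  - split=> [x _||]; first exact: ex_derive.
    + by apply: cvg_at_right_filter; exact: continuous_horner.
    + by apply: cvg_at_left_filter; exact: continuous_horner.
  - by move=> x _; rewrite -derivE.
have SN : S.[- (3 / 4)] = - S.[3 / 4].
  rewrite /S !(hornerD, hornerN, hornerX, hornerXn, hornerZ); ring.
have dSE x : (deriv S).[x] = 1 - x ^+ 2 / 2 + (x ^+ 2 / 2) ^+ 2 / 2 -
    (x ^+ 2 / 2) ^+ 3 / 6 + (x ^+ 2 / 2) ^+ 4 / 24.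
  rewrite /S !(derivXn, derivZ, derivB, derivD, derivN, derivC, derivX).
  by rewrite !(hornerD, hornerN, hornerX, hornerC, hornerXn, hornerZ, hornerMn)/=; field.
have exp_dS x : expR (- (x ^+ 2 / 2)) <= (deriv S).[x].
  by rewrite dSE; apply: expRN_le_taylor; rewrite divr_ge0// sqr_ge0.
have dS0 x : 0 <= (deriv S).[x] by apply: le_trans (exp_dS x); exact: expR_ge0.
rewrite SN in Idef.
have -> : (r * normal_peak r * (2 * S.[3 / 4]))%:E = (r%:E * ((normal_peak r)%:E *
    \int[leb]_(x in `[(- (3 / 4))%R, (3 / 4)%R]) ((deriv S).[x])%:E))%E.
  by rewrite Idef -EFinB -!EFinM; congr EFin; ring.
have mdS D : measurable_fun D (fun x : mR => ((deriv S).[x])%:E).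
  by apply/measurable_EFinP; exact: (@measurable_poly R (deriv S) D).
rewrite lee_pmul2l ?lte_fin// -ge0_integralZl//; last 2 first.
- by move=> x _; rewrite lee_fin.
- by rewrite lee_fin normal_peak_ge0.
rewrite [leRHS]integral_mkcond; apply: ge0_le_integral => //.
- by move=> x _; rewrite mule_ge0// lee_fin.
- have maff : measurable_fun setT (fun x : mR => (r * x + m : mR)).
    by apply: measurable_funD => //; exact: measurable_funM.
  apply: emeasurable_funM; first exact: measurableT_comp mI maff.
  exact: measurableT_comp (mpdf m r) maff.
- apply/(measurable_restrictT _ _).1 => //; exact: emeasurable_funM.
- move=> x _; rewrite patchE; case: ifPn => xD.
    apply: (@le_trans _ _ (normal_pdf m r (r * x + m))%:E).
      by rewrite -EFinM lee_fin ler_piMl ?normal_pdf_ge0// indicE; case: (_ \in _).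
    rewrite normal_pdfE// -EFinM lee_fin ler_wpM2l ?normal_peak_ge0//.
    apply: le_trans (exp_dS x); rewrite /normal_fun addrK exprMn ler_expR.
    by rewrite le_eqVlt; apply/orP; left; apply/eqP; field.
  rewrite indicE memNset ?mul0e//; rewrite /B/= addrK normrM gtr0_norm// mulrC.
  rewrite ltr_pM2r// => /ltr_normlP[h1 h2]; move/negP: xD; apply.
  by rewrite inE/= in_itv/=; apply/andP; split; lra.
Qed.

(** The factor 8/3 is 2 times 4/3: the 2 comes from the two-sided density bound, the 4/3 is the
    reciprocal of the threshold 3/4. Dividing the upper estimate by this lower one then leaves
    exactly 2.35. *)
Lemma normal_law_tail34_ge (m r : R) : 0 < r ->
  ((8 / 3 * (r * normal_peak r) / (235 / 100))%:E <=
   normal_law m r [set x | (3 / 4 * r <= `|x - m|)%R])%E.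
Proof.
move=> r0.
have mB : measurable ([set x : mR | (`|x - m| < 3 / 4 * r)%R]).
  rewrite (_ : [set x | _] = `](m - 3 / 4 * r), (m + 3 / 4 * r)[%classic).
    exact: measurable_itv.
  by apply/seteqP; split=> x; rewrite /= in_itv/= ltr_distl.
have -> : [set x : mR | (3 / 4 * r <= `|x - m|)%R] =
    ~` [set x | (`|x - m| < 3 / 4 * r)%R].
  by apply/seteqP; split=> x /=; rewrite leNgt => /negP.
rewrite probability_setC// leeBrDr ?fin_num_measure//.
apply: le_trans (leeD2l _ (normal_law_ball34_le m r0)) _.
rewrite -EFinD lee_fin normal_peakE//.
have pi0 : 0 < 2 * pi :> R by rewrite mulr_gt0 ?pi_gt0.
have q0 : 0 < Num.sqrt (2 * pi) :> R by rewrite sqrtr_gt0.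
rewrite [leLHS](_ : _ = (8 / 3 / (235 / 100) + 2 * S.[3 / 4]) / Num.sqrt (2 * pi));
  last by ring.
rewrite ler_pdivrMr// mul1r.
(* Multiplied by sqrt(2 pi), the claim is 8 / (3 * 2.35) + 2 S(3/4) <= sqrt(2 pi), roughly 2.5052 <=
   2.5066. The fractions 135/197 and 233/93 are simple rationals that fit in this gap. *)
have S34 : S.[3 / 4] <= 135 / 197.
  by rewrite /S !(hornerD, hornerN, hornerX, hornerXn, hornerZ); lra.
have q2 : (233 / 93) ^+ 2 <= Num.sqrt (2 * pi) ^+ 2 :> R.
  by rewrite sqr_sqrtr ?(ltW pi0)//; have := @pi_half_gt R; lra.
apply: le_trans (_ : 233 / 93 <= _); first by lra.
by rewrite -(@ler_pXn2r _ 2)// nnegrE ?sqrtr_ge0//; lra.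
Qed.

End normal_moments.

(** * Averaging over a Gaussian vector *)

Section averaging.
Context {d : measure_display} {T : measurableType d} {R : realType}.
Variable P : probability T R.
Local Notation mR := (measurableTypeR R).

Lemma gaussian_family_variance_le {I : finType} (mu : I -> R) (r : R)
    (X : I -> T -> mR) i : 0 < r -> gaussian_family P mu r X ->
  (\int[P]_t ((X i t - mu i) ^+ 2)%:E <= (r ^+ 2)%:E)%E.
Proof.
move=> r0 gX; apply: le_trans (normal_variance_le (mu i) r0).
have msq : measurable_fun setT (fun x : mR => ((x - mu i) ^+ 2)%:E).
  by apply/measurable_EFinP; apply: measurable_funX; exact: measurable_funB.
have := @ge0_integral_pushforward _ _ _ _ R (X i) (gX.1 i) P setT _ measurableT msq.
rewrite preimage_setT => <-; last by move=> y _; rewrite lee_fin sqr_ge0.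
rewrite le_eqVlt; apply/orP; left; apply/eqP.
apply: eq_measure_integral => [|mXi A mA _]; first exact: gX.1.
exact: (gaussian_family_marginal i gX mA).
Qed.

(** With s^2 the bound on the second moment, integrating |w| <= (|w|^2 + s^2) / (2 s) gives at most
    s, which replaces an appeal to Jensen's inequality. *)
Lemma gaussian_l2norm_le j m (M0 : 'M[R]_(j.+1, m)) (r : R)
    (Y : T -> 'M[R]_(j.+1, m)) (k : 'I_m) : 0 < r -> gaussian_mx P M0 r Y ->
  (\int[P]_t (l2norm (col k (Y t - M0)))%:E <= (r * Num.sqrt j.+1%:R)%:E)%E.
Proof.
move=> r0 gY; have mY := gaussian_mx_measurable gY.
pose w t := col k (Y t - M0).
have mw : measurable_mx w.
  by move=> i l; under eq_fun do rewrite !mxE; apply: measurable_funD => //; exact: mY.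
have msum : measurable_fun setT (fun t => (l2norm (w t) ^+ 2)%:E).
  by apply/measurable_EFinP; apply: measurable_funX; exact: measurable_l2norm.
pose s := r * Num.sqrt j.+1%:R.
have s0 : 0 < s by rewrite mulr_gt0// sqrtr_gt0.
have sum_le : (\int[P]_t (l2norm (w t) ^+ 2)%:E <= (s ^+ 2)%:E)%E.
  under eq_integral do rewrite sqr_l2norm -sumEFin.
  rewrite ge0_integral_sum//; last 2 first.
  - by move=> i; apply/measurable_EFinP; apply: measurable_funX; exact: mw.
  - by move=> i t _; rewrite lee_fin sqr_ge0.
  apply: (@le_trans _ _ (\sum_(i < j.+1) (r ^+ 2)%:E)%E).
    apply: lee_sum => i _; apply: le_trans (gaussian_family_variance_le (i, k) r0 gY).
    by rewrite le_eqVlt; apply/orP; left; apply/eqP;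
      apply: eq_integral => t _; rewrite !mxE.
  rewrite sumEFin lee_fin sumr_const card_ord /s exprMn sqr_sqrtr// mulr_natr.
  exact: lexx.
apply: (@le_trans _ _ (\int[P]_t ((2 * s)^-1%:E * (l2norm (w t) ^+ 2 + s ^+ 2)%:E))%E).
  apply: ge0_le_integral => //.
  - by move=> t _; rewrite lee_fin l2norm_ge0.
  - by apply/measurable_EFinP; exact: measurable_l2norm.
  - apply: emeasurable_funM => //; apply/measurable_EFinP/measurable_funD => //.
    by apply: measurable_funX; exact: measurable_l2norm.
  - move=> t _; rewrite -EFinM lee_fin mulrC ler_pdivlMr ?mulr_gt0//.
    by have := sqr_ge0 (l2norm (w t) - s); rewrite sqrrB; lra.
rewrite ge0_integralZl//; last 3 first.
- apply/measurable_EFinP/measurable_funD => //.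
  by apply: measurable_funX; exact: measurable_l2norm.
- by move=> t _; rewrite lee_fin addr_ge0 ?sqr_ge0.
- by rewrite lee_fin invr_ge0 mulr_ge0// ltW.
under eq_integral do rewrite EFinD.
rewrite ge0_integralD//; last 2 first.
- by move=> t _; rewrite lee_fin sqr_ge0.
- by move=> t _; rewrite lee_fin sqr_ge0.
rewrite integral_cst// -[X in (_ * (_ + _ * X) <= _)%E]/(P setT) probability_setT mule1.
apply: (@le_trans _ _ ((2 * s)^-1%:E * ((s ^+ 2)%:E + (s ^+ 2)%:E))%E).
  by rewrite lee_pmul2l ?lte_fin ?invr_gt0 ?mulr_gt0// leeD2r.
rewrite -EFinD -EFinM lee_fin le_eqVlt; apply/orP; left; apply/eqP.
by rewrite -/s; field; rewrite gt_eqF.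
Qed.

End averaging.

(** * Tail of the smallest singular value *)

Section smallest_singular_value.
Context {d : measure_display} {T : measurableType d} {R : realType}.
Variable P : probability T R.
Local Notation mR := (measurableTypeR R).

(** The centred form is Gaussian with standard deviation r |u|, so a threshold proportional to |u|
    gives a lower bound independent of u. *)
Lemma gaussian_linear_form_tail n (M0 : 'cV[R]_n.+1) (r : R) (Y : T -> 'cV[R]_n.+1)
    (u : 'cV[R]_n.+1) : 0 < r -> gaussian_mx P M0 r Y -> u != 0 ->
  ((8 / 3 * (r * normal_peak r) / (235 / 100))%:E <=
   P [set t | (3 / 4 * r * l2norm u <= `|(u^T *m (Y t - M0)) 0 0|)%R])%E.
Proof.
move=> r0 gY u0; have r_neq0 : r != 0 by rewrite gt_eqF.
have [l [m [Z [l2 lm mZ PZ uY]]]] := gaussian_linear_form u r_neq0 gY.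
have lu : `|l| = l2norm u.
  by apply/eqP; rewrite -(@eqrXn2 _ 2)// ?l2norm_ge0// real_normK ?num_real// l2.
have u_gt0 : 0 < l2norm u by rewrite l2norm_gt0.
apply: le_trans (normal_law_tail34_ge m r0) _.
rewrite -PZ; last first.
  apply: measurable_setle => //; apply: measurableT_comp => //.
  exact: measurable_funB.
rewrite le_eqVlt; apply/orP; left; apply/eqP; congr (P _).
have uYE t : (u^T *m (Y t - M0)) 0 0 = l * (Z t - m).
  by rewrite mulmxBr [LHS]mxE [X in _ + X]mxE uY -lm mulrBr.
have uZ t : (3 / 4 * r * l2norm u <= `|(u^T *m (Y t - M0)) 0 0|) =
    (3 / 4 * r <= `|Z t - m|).
  by rewrite uYE normrM lu mulrC ler_pM2l.
by apply/seteqP; split=> t; rewrite /= uZ.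
Qed.

(** On the square of the sample space, the first copy supplies w and the second one N. Integrated
    over w first, the event [F] has probability at least [kappa] times that of [A]; integrated over
    N first, it is bounded through the mean of |w|. Fubini's theorem compares the two. *)
Lemma gaussian_smallest_singular_value j m (M : 'M[R]_(m, j)) (K r x : R)
    (M0 : 'M[R]_(j, m)) (Y : T -> 'M[R]_(j, m)) (A : set T) :
  (0 < j)%N -> 0 < r -> 0 <= K -> (forall v : 'cV_j, l2norm v <= K * l2norm (M *m v)) ->
  gaussian_mx P M0 r Y -> 0 < x -> measurable A ->
  (forall t, A t -> Y t *m M \in unitmx /\
     exists2 z : 'cV_j, l2norm z = 1 & x <= l2norm (invmx (Y t *m M) *m z)) ->
  (P A <= (235 / 100 * Num.sqrt j%:R * K / (r * x))%:E)%E.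
Proof.
case: j M M0 Y => [//|j] M M0 Y _.
move=> r0 K0 MK gY x0 mA Ax; have r_neq0 : r != 0 by rewrite gt_eqF.
case: m M M0 Y MK gY Ax => [|m] M M0 Y MK gY Ax.
  have := MK (delta_mx 0 0); rewrite l2norm_delta [M]flatmx0 mul0mx l2norm0 mulr0.
  by rewrite ler10.
have mY := gaussian_mx_measurable gY.
pose w t := col 0 (Y t - M0); pose N t := Y t *m M.
(* The threshold 3/4 r |u| of the linear form, for the smallest |u| allowed, namely x. *)
pose tau := 3 / 4 * r * x.
have tau0 : 0 < tau by rewrite !mulr_gt0.
pose F := [set z : T * T | tau * `|\det (N z.2)| <= l2norm (\adj (N z.2) *m w z.1)].
have mN : measurable_mx N by apply: measurable_mulmx => //; exact: measurable_cst_mx.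
have mw : measurable_mx w.
  by move=> i k; under eq_fun do rewrite !mxE; apply: measurable_funD => //; exact: mY.
have mF : measurable F.
  have mN2 : measurable_mx (fun z : T * T => N z.2).
    by move=> i k; exact: (measurableT_comp (mN i k) measurable_snd).
  have mw1 : measurable_mx (fun z : T * T => w z.1).
    by move=> i k; exact: (measurableT_comp (mw i k) measurable_fst).
  apply: measurable_setle.
    by apply: measurable_funM => //; apply: measurableT_comp => //; exact: measurable_det.
  by apply: measurable_l2norm; apply: measurable_mulmx => //; exact: measurable_adjugate.
have mI : measurable_fun setT (fun z : T * T => (\1_F z : R)%:E).
  by apply/measurable_EFinP; exact: measurable_indic.
have I0 (z : T * T) : (0 <= (\1_F z : R)%:E)%E by rewrite lee_fin.
have mFx t' : measurable [set t : T | F (t', t)].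
  by rewrite -[X in measurable X]setTI; exact: (pair1_measurable t' measurableT mF).
have mFy t : measurable [set t' : T | F (t', t)].
  by rewrite -[X in measurable X]setTI; exact: (pair2_measurable t measurableT mF).
have intx t' : (\int[P]_t (\1_F (t', t) : R)%:E = P [set t | F (t', t)])%E.
  transitivity (\int[P]_t (\1_[set t : T | F (t', t)] t : R)%:E)%E; first by [].
  by rewrite integral_indic ?setIT//; exact: mFx.
have inty t : (\int[P]_t' (\1_F (t', t) : R)%:E = P [set t' | F (t', t)])%E.
  transitivity (\int[P]_t' (\1_[set t' : T | F (t', t)] t' : R)%:E)%E; first by [].
  by rewrite integral_indic ?setIT//; exact: mFy.
pose kappa := 8 / 3 * (r * normal_peak r) / (235 / 100).
have kappa0 : 0 < kappa by rewrite !mulr_gt0// normal_peak_gt0.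
have lower : (kappa%:E * P A <= \int[P]_t \int[P]_t' (\1_F (t', t) : R)%:E)%E.
  rewrite -(setIT A) -integral_indic// -ge0_integralZl//; last 2 first.
  - by apply/measurable_EFinP; exact: measurable_indic.
  - by rewrite lee_fin ltW.
  apply: ge0_le_integral => //.
  - by move=> t _; rewrite mule_ge0// lee_fin// ltW.
  - by apply: emeasurable_funM => //; apply/measurable_EFinP; exact: measurable_indic.
  - exact: (measurable_fun_fubini_tonelli_G (fun z => (\1_F z)%:E)).
  move=> t _; rewrite inty indicE; case: (boolP (t \in A)) => [|_]; last by rewrite mule0.
  rewrite inE mule1 => /Ax[uN [z z1 xz]].
  have p_gt0 : 0 < l2norm (invmx (N t) *m z) by exact: lt_le_trans x0 xz.
  set p := invmx (N t) *m z in xz p_gt0.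
  (* For the unit vector e along N^-1 z and u = N^-T e, one has <u, v> = <e, N^-1 v>. Taking v = z
     gives |u| >= |N^-1 z| >= x, and v = w gives |N^-1 w| >= |<u, w>|. *)
  pose e := (l2norm p)^-1 *: p.
  have e1 : l2norm e = 1 by apply: l2norm_normalize; rewrite -l2norm_gt0.
  pose u := (invmx (N t))^T *m e.
  have uT (v : 'cV_j.+1) : u^T *m v = e^T *m (invmx (N t) *m v).
    by rewrite trmx_mul trmxK mulmxA.
  have xu : x <= l2norm u.
    have := Cauchy_Schwarz u z; rewrite z1 mulr1 uT -/p.
    have -> : (e^T *m p) 0 0 = l2norm p.
      have -> : e^T = (l2norm p)^-1 *: p^T by apply/matrixP => a b; rewrite !mxE.
      rewrite -scalemxAl mxE -sqr_l2normE expr2 mulrA mulVf ?mul1r//.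
      by rewrite gt_eqF.
    by rewrite ger0_norm ?l2norm_ge0//; exact: le_trans.
  have u0 : u != 0 by rewrite -l2norm_gt0 (lt_le_trans x0).
  have gw : gaussian_mx P (col 0 M0) r (fun t' => col 0 (Y t')).
    have inj0 : injective (fun _ : 'I_1 => 0 : 'I_m.+1) by move=> ? ? _; rewrite !ord1.
    have := gaussian_mx_sub (@inj_id _) inj0 gY; rewrite /gaussian_mx.
    by congr (gaussian_family P _ r _).
  have wE t' : w t' = col 0 (Y t') - col 0 M0 by rewrite /w linearB.
  apply: le_trans (gaussian_linear_form_tail r0 gw u0) _.
  apply: le_measure; rewrite ?inE.
  - have mw' : measurable_mx (fun t' => u^T *m (col 0 (Y t') - col 0 M0)).
      apply: measurable_mulmx; first exact: measurable_cst_mx.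
      by move=> i k; have := mw i k; under eq_fun do rewrite wE.
    by apply: measurable_setle => //; apply: measurableT_comp => //; exact: mw'.
  - exact: mFy.
  - move=> t' /=; rewrite -wE uT => h; rewrite /F /=.
    have -> : \adj (N t) = \det (N t) *: invmx (N t).
      rewrite /invmx uN scalerA divff ?scale1r//.
      by have := uN; rewrite unitmxE unitfE.
    rewrite -scalemxAl l2normZ mulrC ler_wpM2l//.
    apply: le_trans (_ : 3 / 4 * r * l2norm u <= _).
      by rewrite ler_wpM2l// mulr_ge0// ltW.
    apply: le_trans h _; apply: le_trans (Cauchy_Schwarz _ _) _.
    by rewrite e1 mul1r.
have upper : (\int[P]_t' \int[P]_t (\1_F (t', t) : R)%:E <=
    (2 * (K / tau) * normal_peak r * (r * Num.sqrt j.+1%:R))%:E)%E.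
  apply: (@le_trans _ _ (\int[P]_t' ((2 * (K / tau) * normal_peak r)%:E *
     (l2norm (w t'))%:E))%E).
    apply: ge0_le_integral => //.
    - by move=> t' _; exact: integral_ge0.
    - exact: (measurable_fun_fubini_tonelli_F (fun z => (\1_F z)%:E)).
    - by apply: emeasurable_funM => //; apply/measurable_EFinP; exact: measurable_l2norm.
    - move=> t' _; rewrite intx.
      apply: le_trans (gaussian_det_adj_bound (w t') r_neq0 K0 MK gY tau0) _.
      by rewrite -EFinM lee_fin le_eqVlt; apply/orP; left; apply/eqP; ring.
  rewrite ge0_integralZl//; last 3 first.
  - by apply/measurable_EFinP; exact: measurable_l2norm.
  - by move=> t _; rewrite lee_fin l2norm_ge0.
  - by rewrite lee_fin !mulr_ge0 ?normal_peak_ge0 ?invr_ge0// ltW.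
  rewrite [leRHS]EFinM lee_wpmul2l
    ?lee_fin ?mulr_ge0 ?normal_peak_ge0 ?invr_ge0 ?(ltW tau0)//.
  exact: gaussian_l2norm_le.
rewrite (fubini_tonelli (fun z => (\1_F z)%:E)) in upper => //.
have := le_trans lower upper.
(* Division by [kappa] cancels the peak of the density and the factors 2 and 4/3. *)
rewrite -(fineK (fin_num_measure P A mA)) -EFinM !lee_fin mulrC -ler_pdivlMr//.
move=> /le_trans; apply; rewrite le_eqVlt; apply/orP; left; apply/eqP.
have p0 : normal_peak r != 0 by rewrite gt_eqF// normal_peak_gt0.
by rewrite /kappa /tau; field; rewrite p0 r_neq0 gt_eqF.
Qed.

End smallest_singular_value.

(** * Spectral norm and pseudo-inverse *)

Section spectral_norm.
Context {R : realType}.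

(** The witness is the Frobenius norm; it ensures that the supremum in [spectral_norm] is over a
    bounded set. *)
Lemma l2norm_mulmx_bounded a b (B : 'M[R]_(a, b)) :
  exists2 C, 0 <= C & forall x, l2norm (B *m x) <= C * l2norm x.
Proof.
exists (Num.sqrt (\sum_i l2norm (row i B)^T ^+ 2)); first exact: sqrtr_ge0.
move=> x; rewrite -(@ler_pXn2r _ 2)// ?nnegrE ?mulr_ge0 ?l2norm_ge0 ?sqrtr_ge0//.
rewrite exprMn [X in _ <= X * _]sqr_sqrtr; last first.
  by apply: sumr_ge0 => i _; exact: sqr_ge0.
rewrite [l2norm (B *m x) ^+ 2]sqr_l2norm mulr_suml; apply: ler_sum => i _.
have -> : (B *m x) i 0 = (((row i B)^T)^T *m x) 0 0.
  by rewrite trmxK -row_mul [RHS]mxE.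
rewrite -exprMn -[leLHS]real_normK ?num_real//.
by rewrite ler_pXn2r ?nnegrE ?mulr_ge0 ?l2norm_ge0// Cauchy_Schwarz.
Qed.

Lemma l2norm_le_spectral a b (B : 'M[R]_(a, b)) x :
  l2norm (B *m x) <= spectral_norm B * l2norm x.
Proof.
have [->|x0] := eqVneq x 0; first by rewrite mulmx0 !l2norm0 mulr0.
have x_gt0 : 0 < l2norm x by rewrite l2norm_gt0.
rewrite -ler_pdivrMr// mulrC -[X in X * _]ger0_norm ?invr_ge0 ?l2norm_ge0//.
rewrite -l2normZ scalemxAr; apply: ub_le_sup.
  have [C C0 BC] := l2norm_mulmx_bounded B.
  by exists C => _ [z /= z1 <-]; rewrite (le_trans (BC z))// z1 mulr1.
by exists ((l2norm x)^-1 *: x) => //=; exact: l2norm_normalize.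
Qed.

Lemma spectral_norm_le a b (B : 'M[R]_(a, b)) c : 0 <= c ->
  (forall x, l2norm (B *m x) <= c * l2norm x) -> spectral_norm B <= c.
Proof.
move=> c0 Bc; rewrite /spectral_norm; set E := [set _ | _ in _].
(* Without columns there is no unit vector, and the supremum of the empty set is 0. *)
have [->|E0] := eqVneq E set0; first by rewrite sup0.
apply: ge_sup; first exact/set0P.
by move=> _ [x /= x1 <-]; rewrite (le_trans (Bc x))// x1 mulr1.
Qed.

Lemma spectral_norm_ge0 a b (B : 'M[R]_(a, b)) : 0 <= spectral_norm B.
Proof.
case: b B => [|b] B.
  rewrite /spectral_norm (_ : [set _ | _ in _] = set0) ?sup0//.
  apply/seteqP; split=> // _ [x /= + _]; rewrite [x]flatmx0 l2norm0 => /eqP.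
  by rewrite eq_sym oner_eq0.
have := l2norm_le_spectral B (delta_mx 0 0).
by rewrite l2norm_delta mulr1; exact: le_trans (l2norm_ge0 _).
Qed.

(** From |C^T y|^2 = <y, C C^T y> <= |y| |C| |C^T y|, one factor |C^T y| is cancelled; the converse
    inequality is the same one for the transpose. *)
Lemma spectral_norm_tr a b (B : 'M[R]_(a, b)) : spectral_norm B^T = spectral_norm B.
Proof.
suff le_tr c e (C : 'M[R]_(c, e)) : spectral_norm C^T <= spectral_norm C.
  by apply/le_anti/andP; split=> //; rewrite -{1}[B]trmxK.
apply: spectral_norm_le => [|y]; first exact: spectral_norm_ge0.
have [->|Cy0] := eqVneq (C^T *m y) 0.
  by rewrite l2norm0 mulr_ge0 ?spectral_norm_ge0 ?l2norm_ge0.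
have Cy_gt0 : 0 < l2norm (C^T *m y) by rewrite l2norm_gt0.
rewrite -(ler_pM2r Cy_gt0) -expr2 sqr_l2normE trmx_mul trmxK -mulmxA.
apply: le_trans (ler_norm _) _; apply: le_trans (Cauchy_Schwarz _ _) _.
rewrite [spectral_norm C * _]mulrC -mulrA ler_wpM2l ?l2norm_ge0//.
exact: l2norm_le_spectral.
Qed.

Lemma lt_spectral_norm a b (B : 'M[R]_(a, b)) c : 0 <= c -> c < spectral_norm B ->
  exists2 z, l2norm z = 1 & c <= l2norm (B *m z).
Proof.
move=> c0 cB; apply: contrapT => H; move: cB; rewrite ltNge => /negP; apply.
apply: spectral_norm_le => // x.
have [->|x0] := eqVneq x 0; first by rewrite mulmx0 !l2norm0 mulr0.
have x_gt0 : 0 < l2norm x by rewrite l2norm_gt0.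
rewrite leNgt; apply/negP => cx; apply: H.
exists ((l2norm x)^-1 *: x); first exact: l2norm_normalize.
rewrite -scalemxAr l2normZ ger0_norm ?invr_ge0 ?l2norm_ge0//.
by rewrite mulrC ler_pdivlMr// ltW.
Qed.

Lemma moore_penrose_unit n (B : 'M[R]_n) : B \in unitmx -> moore_penrose B = invmx B.
Proof.
move=> uB; apply: (@is_moore_penrose_inj _ _ _ B); first exact: moore_penroseP.
by split; rewrite ?mulmxV ?mulVmx ?mul1mx ?trmx1.
Qed.

Lemma moore_penrose_tr a b (B : 'M[R]_(a, b)) :
  moore_penrose B^T = (moore_penrose B)^T.
Proof.
apply: (@is_moore_penrose_inj _ _ _ B^T); first exact: moore_penroseP.
have [BXB XBX BXt XBt] := moore_penroseP B.
by split; rewrite -?trmx_mul ?mulmxA ?BXB ?XBX ?BXt ?XBt.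
Qed.

(* The pseudo-inverse maps onto the range of [B^T], where it inverts [B]. *)
Lemma spectral_norm_moore_penrose_le a b (B : 'M[R]_(a, b)) c : 0 <= c ->
  spectral_norm (moore_penrose B) <= c <->
  forall q, l2norm (B^T *m q) <= c * l2norm (B *m B^T *m q).
Proof.
move=> c0; have [BXB XBX BXt XBt] := moore_penroseP B.
set X := moore_penrose B in BXB XBX BXt XBt *.
have BtE : X *m B *m B^T = B^T by rewrite -{1}XBt -trmx_mul mulmxA BXB.
split=> [Xc q|H].
  rewrite -{1}BtE -!mulmxA; apply: le_trans (l2norm_le_spectral _ _) _.
  by rewrite mulmxA ler_wpM2r// l2norm_ge0.
apply: spectral_norm_le => // y.
have XE : X = B^T *m (X^T *m X) by rewrite mulmxA -trmx_mul XBt XBX.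
rewrite XE -mulmxA; apply: le_trans (H _) _; rewrite ler_wpM2l//.
rewrite -mulmxA [B^T *m _]mulmxA -XE mulmxA.
(* [B *m X] is an orthogonal projection. *)
have [Z0|Z0] := eqVneq (B *m X *m y) 0; first by rewrite Z0 l2norm0 l2norm_ge0.
have Z_gt0 : 0 < l2norm (B *m X *m y) by rewrite l2norm_gt0.
rewrite -(ler_pM2r Z_gt0) -expr2.
have -> : l2norm (B *m X *m y) ^+ 2 = (y^T *m (B *m X *m y)) 0 0.
  rewrite sqr_l2normE trmx_mul BXt -[y^T *m _ *m _]mulmxA.
  by rewrite [B *m X *m (B *m X *m y)]mulmxA [B *m X *m (B *m X)]mulmxA BXB.
by apply: le_trans (ler_norm _) (Cauchy_Schwarz _ _).
Qed.

Lemma rational_approximation n (x : 'cV[R]_n) e : 0 < e ->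
  exists q : 'cV[rat]_n, l2norm (x - map_mx ratr q) <= e.
Proof.
(* The summand 1 keeps the denominator positive when n = 0. *)
move=> e0; pose delta := e / (Num.sqrt n%:R + 1).
have s0 : 0 < Num.sqrt n%:R + 1 :> R by rewrite ltr_wpDl ?sqrtr_ge0.
have d0 : 0 < delta by rewrite divr_gt0.
have /choice[f fP] : forall i, exists q : rat, `|x i 0 - ratr q| <= delta.
  move=> i; have /rat_in_itvoo[q] : x i 0 - delta < x i 0 + delta by lra.
  by rewrite in_itv/= => /andP[h1 h2]; exists q; rewrite ler_norml; lra.
exists (\col_i f i); rewrite -(@ler_pXn2r _ 2)// ?nnegrE ?l2norm_ge0 ?(ltW e0)//.
rewrite sqr_l2norm; apply: (@le_trans _ _ (\sum_(i < n) delta ^+ 2)).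
  apply: ler_sum => i _; rewrite !mxE -[leLHS]real_normK ?num_real//.
  by rewrite ler_pXn2r ?nnegrE ?(ltW d0).
rewrite sumr_const card_ord -mulr_natr -[n%:R]sqr_sqrtr// -exprMn.
rewrite ler_pXn2r ?nnegrE ?mulr_ge0 ?sqrtr_ge0 ?(ltW d0) ?(ltW e0)//.
by rewrite /delta mulrAC ler_pdivrMr// ler_pM2l// lerDl ler01.
Qed.

(** Both sides are Lipschitz in x, with constants adding up to [K], so approximating x by a rational
    vector changes the inequality by at most e. *)
Lemma l2norm_le_rational a a' n (A : 'M[R]_(a, n)) (B : 'M[R]_(a', n)) c : 0 <= c ->
  (forall q : 'cV[rat]_n, l2norm (A *m map_mx ratr q) <=
    c * l2norm (B *m map_mx ratr q)) ->
  forall x, l2norm (A *m x) <= c * l2norm (B *m x).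
Proof.
move=> c0 H x; apply/ler_addgt0Pr => e e0.
pose K := spectral_norm A + c * spectral_norm B.
have K0 : 0 <= K by rewrite addr_ge0 ?mulr_ge0 ?spectral_norm_ge0.
have K1 : 0 < K + 1 by rewrite ltr_wpDl.
have [q qe] := rational_approximation x (divr_gt0 e0 K1).
set r := map_mx ratr q in qe; set v := x - r in qe.
have -> : x = r + v by rewrite /v addrC subrK.
have Kv : K * l2norm v <= e.
  apply: (@le_trans _ _ ((K + 1) * (e / (K + 1)))).
    by apply: ler_pM; rewrite ?l2norm_ge0//; lra.
  by rewrite mulrCA divff ?mulr1// gt_eqF.
have rE : r = (r + v) + (-1) *: v by rewrite scaleN1r addrK.
have Br : l2norm (B *m r) <= l2norm (B *m (r + v)) + spectral_norm B * l2norm v.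
  rewrite {1}rE mulmxDr; apply: le_trans (l2norm_triangle _ _) _.
  rewrite lerD2l; apply: le_trans (l2norm_le_spectral _ _) _.
  by rewrite l2normZ normrN1 mul1r.
rewrite mulmxDr; apply: le_trans (l2norm_triangle _ _) _.
have h1 := H q; have h2 := l2norm_le_spectral A v; rewrite -/r in h1.
have h3 : c * l2norm (B *m r) <=
    c * (l2norm (B *m (r + v)) + spectral_norm B * l2norm v) by rewrite ler_wpM2l.
by move: Kv; rewrite /K; lra.
Qed.

End spectral_norm.

(** * Measurability of the norm of the pseudo-inverse *)

Section measurable_pseudo_inverse.
Context {d : measure_display} {T : measurableType d} {R : realType}.

(** The pseudo-inverse is discontinuous where the rank drops. By [spectral_norm_moore_penrose_le]
    its norm is at most c exactly when inequalities in the entries of A alone hold for all vectors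
    q; rational q suffice, which leaves a countable intersection of measurable events. *)
Lemma measurable_spectral_norm_moore_penrose a b (A : T -> 'M[R]_(a, b)) :
  measurable_mx A -> measurable_fun setT (fun t => spectral_norm (moore_penrose (A t))).
Proof.
move=> mA; apply: (measurability _ (RGenOInfty.measurableE R)) => //.
move=> _ [_ [c ->] <-]; rewrite setTI.
have [c0|c0] := ltP c 0.
  rewrite (_ : _ @^-1` _ = setT)//; apply/seteqP; split=> t //= _.
  by rewrite in_itv/= andbT (lt_le_trans c0)// spectral_norm_ge0.
rewrite -[X in measurable X]setCK; apply: measurableC.
pose F (q : 'cV[rat]_a) := [set t | l2norm ((A t)^T *m map_mx ratr q) <=
  c * l2norm (A t *m (A t)^T *m map_mx ratr q)].
rewrite (_ : ~` _ = \bigcap_(k in [set: nat])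
    if unpickle k is Some q then F q else setT); last first.
  apply/seteqP; split=> t /=.
    rewrite in_itv/= andbT => /negP; rewrite -leNgt => h k _.
    case: unpickle => [q|//]; rewrite /F/=.
    by apply: ((spectral_norm_moore_penrose_le _ c0).1 h).
  move=> h; rewrite in_itv/= andbT; apply/negP; rewrite -leNgt.
  apply/(spectral_norm_moore_penrose_le _ c0); apply: l2norm_le_rational => // q.
  by have := h (pickle q) I; rewrite pickleK.
apply: bigcap_measurableType => k _; case: unpickle => [q|//].
have mT := measurable_trmx mA.
apply: measurable_setle.
  by apply: measurable_l2norm; apply: measurable_mulmx => //; exact: measurable_cst_mx.
apply: measurable_funM => //; apply: measurable_l2norm.
by apply: measurable_mulmx; [exact: measurable_mulmx|exact: measurable_cst_mx].
Qed.

End measurable_pseudo_inverse.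

(** * Leading blocks and rank profile *)

Section leading_blocks.
Context {R : realType}.

Lemma pid_mulmx_rowsub a b j (ja : (j <= a)%N) (A : 'M[R]_(a, b)) :
  (pid_mx j : 'M[R]_(j, a)) *m A = mxsub (widen_ord ja) id A.
Proof.
apply/matrixP => i k; rewrite !mxE (bigD1 (widen_ord ja i))//= big1 ?addr0.
  by rewrite mxE /= eqxx ltn_ord mul1r.
move=> l li; rewrite mxE (_ : (i == l :> nat) = false) ?mul0r//.
by apply/negP => /eqP il; move/eqP: li; apply; apply: val_inj.
Qed.

Lemma leading_block_mulmx a b c j (ja : (j <= a)%N) (A : 'M[R]_(a, b))
    (M : 'M[R]_(b, c)) :
  leading_block j (A *m M) = mxsub (widen_ord ja) id A *m first_cols j M.
Proof.
by rewrite /leading_block /first_rows /first_cols -mulmxA mulmxA pid_mulmx_rowsub.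
Qed.

Lemma first_rows_tr a b j (M : 'M[R]_(a, b)) : first_rows j M = (first_cols j M^T)^T.
Proof. by rewrite /first_rows /first_cols trmx_mul trmxK tr_pid_mx. Qed.

Lemma leading_block_tr a b j (B : 'M[R]_(a, b)) :
  leading_block j B^T = (leading_block j B)^T.
Proof.
by rewrite /leading_block /first_rows /first_cols !trmx_mul !tr_pid_mx mulmxA.
Qed.

Lemma generic_rank_profile_tr a b (B : 'M[R]_(a, b)) :
  generic_rank_profile B^T <-> generic_rank_profile B.
Proof.
by split=> H i; [have := H i|have := H i]; rewrite leading_block_tr unitmx_tr mxrank_tr.
Qed.

(** Turns a rank condition into finitely many conditions on determinants, hence into a measurable
    event; finite functions are used as indices so that the union ranges over a finite type. *)
Lemma leq_mxrank_minor a b (B : 'M[R]_(a, b)) i :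
  (i <= \rank B)%N <->
  exists f : {ffun 'I_i -> 'I_a} * {ffun 'I_i -> 'I_b}, \det (mxsub f.1 f.2 B) != 0.
Proof.
split=> [iB|[[f g] /= fg]].
  pose C := mxsub (widen_ord iB) id (rowsub (maxrankfun B) B).
  have Cfree : row_free C.
    rewrite /row_free /C -pid_mulmx_rowsub mxrankMfree ?maxrowsub_free//.
    by rewrite rank_pid_mx.
  have Ctfull : row_full C^T by rewrite /row_full mxrank_tr.
  exists ([ffun k => maxrankfun B (widen_ord iB k)], fullrankfun Ctfull) => /=.
  rewrite (_ : mxsub _ _ B = (rowsub (fullrankfun Ctfull) C^T)^T).
    by rewrite det_tr -unitfE -unitmxE fullrowsub_unit.
  by apply/matrixP => k l; rewrite !mxE ffunE.
have : \rank (mxsub f g B) = i.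
  by apply/eqP; rewrite -[_ == _]/(row_free _) row_free_unit unitmxE unitfE.
move=> <-; apply: (@leq_trans (\rank (colsub g B))).
  have -> : mxsub f g B = rowsub f (colsub g B) by apply/matrixP => k l; rewrite !mxE.
  exact/mxrankS/rowsub_sub.
rewrite -mxrank_tr -[leqRHS]mxrank_tr.
have -> : (colsub g B)^T = rowsub g B^T by apply/matrixP => k l; rewrite !mxE.
exact/mxrankS/rowsub_sub.
Qed.

Lemma measurable_generic_rank_profile d (T : measurableType d) a b
    (B : T -> 'M[R]_(a, b)) : measurable_mx B ->
  measurable [set t | generic_rank_profile (B t)].
Proof.
move=> mB; pose S i := [set t | (i <= \rank (B t))%N].
pose D i := [set t | \det (leading_block i (B t)) = 0].
have mdet0 n (C : T -> 'M[R]_n) : measurable_mx C -> measurable [set t | \det (C t) = 0].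
  by move=> mC; apply: measurable_seteq => //; exact: measurable_det.
rewrite (_ : [set t | _] = \bigcap_(i in [set i | (1 <= i)%N]) ~` (S i `&` D i)).
  apply: bigcap_measurableType => i _; apply/measurableC/measurableI.
    rewrite (_ : S i = \big[setU/set0]_(f : {ffun 'I_i -> 'I_a} * {ffun 'I_i -> 'I_b})
        ~` [set t | \det (mxsub f.1 f.2 (B t)) = 0]).
      apply: bigsetU_measurable => f _; apply: measurableC.
      by apply: mdet0; exact: measurable_mxsub.
    apply/seteqP; split=> t.
      move=> /leq_mxrank_minor[f /eqP f0].
      by rewrite -bigcup_seq_cond; exists f => //=; rewrite mem_index_enum.
    rewrite -bigcup_seq_cond => -[f _ /= /eqP f0].
    by apply/leq_mxrank_minor; exists f.
  apply: mdet0; rewrite /leading_block /first_rows /first_cols.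
  apply: measurable_mulmx; first exact: measurable_cst_mx.
  by apply: measurable_mulmx => //; exact: measurable_cst_mx.
apply/seteqP; split=> t H i.
  by move=> /= i1 [Si Di]; have := H i; rewrite i1 Si unitmxE unitfE Di eqxx => /(_ isT).
move=> /andP[i1 Si]; rewrite unitmxE unitfE; apply/negP => /eqP Di.
exact: (H i i1).
Qed.

End leading_blocks.

(** * Gaussian preconditioning *)

Section gaussian_preconditioning.
Context {d : measure_display} {T : measurableType d} {R : realType}.
Variable P : probability T R.

Lemma gaussian_matrixP a b (mu sigma : R) (G : 'M[{RV P >-> R}]_(a, b)) :
  gaussian_matrix mu sigma G -> gaussian_mx P (const_mx mu) sigma (sample G).
Proof.
move=> [normG indG].
have := gaussian_familyP (X := fun ij : 'I_a * 'I_b => G ij.1 ij.2)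
  (fun ij => normG ij.1 ij.2) indG.
rewrite /gaussian_mx; congr (gaussian_family P _ sigma _).
  by apply/funext => ij; rewrite mxE.
by apply/funext => ij; apply/funext => t; rewrite mxE.
Qed.

Section leading_block_of_product.
Context {q m n j : nat} (M : 'M[R]_(m, n)) (M0 : 'M[R]_(q, m)) (sigma : R).
Context (Y : T -> 'M[R]_(q, m)).
Hypotheses (sigma_gt0 : 0 < sigma) (gY : gaussian_mx P M0 sigma Y).
Hypotheses (j1q : (1 <= j <= q)%N) (rankM : \rank (first_cols j M) = j).

Let jq : (j <= q)%N. Proof. by case/andP: j1q. Qed.
Let N t := leading_block j (Y t *m M).
Let X := moore_penrose (first_cols j M).

Let gY' : gaussian_mx P (mxsub (widen_ord jq) id M0) sigma
  (fun t => mxsub (widen_ord jq) id (Y t)).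
Proof.
by apply: gaussian_mx_sub => //; move=> i k /(congr1 val)/= ik; apply: val_inj.
Qed.

Let NE t : N t = mxsub (widen_ord jq) id (Y t) *m first_cols j M.
Proof. exact: leading_block_mulmx. Qed.

Let MK (v : 'cV_j) : l2norm v <= spectral_norm X * l2norm (first_cols j M *m v).
Proof.
have [MXM _ _ _] := moore_penroseP (first_cols j M).
(* Full column rank makes the pseudo-inverse a left inverse, so its norm serves as the constant
   K. *)
have XM : X *m first_cols j M = 1%:M.
  have free : row_free (first_cols j M)^T by rewrite /row_free mxrank_tr rankM.
  apply: trmx_inj; apply: (row_free_inj free); rewrite -!trmx_mul.
  by rewrite mulmxA MXM mulmx1.
by rewrite -{1}[v]mul1mx -XM -mulmxA; exact: l2norm_le_spectral.
Qed.

Let mN : measurable_mx N.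
Proof.
rewrite (_ : N = fun t => mxsub (widen_ord jq) id (Y t) *m first_cols j M).
  apply: measurable_mulmx; first exact: (gaussian_mx_measurable gY').
  exact: measurable_cst_mx.
by apply/funext => t; rewrite NE.
Qed.

Lemma leading_block_det_neq0 : P [set t | \det (leading_block j (Y t *m M)) = 0] = 0%E.
Proof.
have sigma0 : sigma != 0 by rewrite gt_eqF.
rewrite -(gaussian_det_neq0 sigma0 (spectral_norm_ge0 X) MK gY').
by congr (P _); apply/seteqP; split=> t /=; rewrite -/(N t) NE.
Qed.

Lemma leading_block_inverse_bound y : 0 <= y ->
  (P [set t | (1 / spectral_norm (moore_penrose (N t)) <= y)%R] <=
   (235 / 100 * y * Num.sqrt j%:R * spectral_norm X / sigma)%:E)%E.
Proof.
move=> y0; pose f t := spectral_norm (moore_penrose (N t)).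
have mf : measurable_fun setT f by exact: measurable_spectral_norm_moore_penrose.
have f0 t : 0 <= f t by exact: spectral_norm_ge0.
pose D := [set t | \det (N t) = 0].
have mD : measurable D by apply: measurable_seteq => //; exact: measurable_det.
pose A := [set t | 1 <= y * f t] `&` ~` D.
have mA : measurable A.
  apply: measurableI; last exact: measurableC.
  by apply: measurable_setle => //; exact: measurable_funM.
have mE : measurable [set t | 1 / f t <= y].
  (* Since 1 / 0 = 0 <= y, the event contains the points where the norm vanishes; they all lie in
     the null set [D] by [f_neq0] below. *)
  rewrite (_ : [set t | _] = [set t | 1 <= y * f t] `|` [set t | f t = 0]).
    apply: measurableU; last exact: measurable_seteq.
    by apply: measurable_setle => //; exact: measurable_funM.
  apply/seteqP; split=> t /=.
    have [->|ft] := eqVneq (f t) 0; first by right.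
    by rewrite ler_pdivrMr; [left|rewrite lt0r ft f0].
  have [->|ft] := eqVneq (f t) 0; first by rewrite invr0 !mulr0.
  by rewrite ler_pdivrMr ?lt0r ?ft ?f0//; case=> // /eqP; rewrite (negbTE ft).
have N_f t : ~ D t -> N t \in unitmx /\ f t = spectral_norm (invmx (N t)).
  move=> /eqP Dt; have uN : N t \in unitmx by rewrite unitmxE unitfE.
  by split=> //; rewrite /f moore_penrose_unit.
have f_neq0 t : ~ D t -> f t != 0.
  move=> /N_f[uN fE]; apply/negP => /eqP; rewrite fE => s0.
  have j0 : (0 < j)%N by case/andP: j1q.
  have := l2norm_le_spectral (invmx (N t)) (N t *m delta_mx (Ordinal j0) 0).
  by rewrite mulKmx// l2norm_delta s0 mul0r ler10.
have EA : [set t | 1 / f t <= y] `<=` A `|` D.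
  move=> t /= ty; have [Dt|Dt] := pselect (D t); [by right|left; split=> //=].
  by rewrite -ler_pdivrMr ?lt0r ?f_neq0 ?f0.
apply: (@le_trans _ _ (P A)).
  apply: (@le_trans _ _ (P (A `|` D))).
    by apply: le_measure; rewrite ?inE//; exact: measurableU.
  apply: le_trans (measureU2 _ mA mD) _.
  by rewrite [X in (_ + X)%E]leading_block_det_neq0 adde0.
pose L := 235 / 100 * Num.sqrt j%:R * spectral_norm X / sigma.
have L0 : 0 <= L.
  by rewrite !mulr_ge0 ?sqrtr_ge0 ?spectral_norm_ge0 ?invr_ge0// ltW.
have -> : 235 / 100 * y * Num.sqrt j%:R * spectral_norm X / sigma = L * y.
  by rewrite /L; ring.
move: y0; rewrite le_eqVlt => /predU1P[y0|y_gt0].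
  have -> : A = set0.
    by apply/seteqP; split=> t //= [/=]; rewrite -y0 mul0r ler10.
  by rewrite measure0 -y0 mulr0.
apply/lee_addgt0Pr => e e0; pose k := e / (L * y + 1).
have Ly1 : 0 < L * y + 1 by rewrite ltr_wpDl// mulr_ge0// ltW.
have k0 : 0 < k by rewrite divr_gt0.
pose x := (y * (1 + k))^-1.
have x0 : 0 < x by rewrite invr_gt0 mulr_gt0// addr_gt0.
have PAx : (P A <= (L / x)%:E)%E.
  have Ax t : A t -> N t \in unitmx /\
      exists2 z : 'cV_j, l2norm z = 1 & x <= l2norm (invmx (N t) *m z).
    move=> [/= yf /N_f[uN fE]]; split=> //; apply: lt_spectral_norm; first exact: ltW.
    rewrite -fE; apply: (@lt_le_trans _ _ y^-1).
      by rewrite ltf_pV2 ?posrE ?mulr_gt0 ?addr_gt0// ltr_pMr// ltrDl.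
    by rewrite -[y^-1]mul1r ler_pdivrMr// mulrC.
  have j0 : (0 < j)%N by case/andP: j1q.
  have := gaussian_smallest_singular_value j0 sigma_gt0 (spectral_norm_ge0 X) MK gY' x0 mA.
  rewrite [_ / (sigma * x)](_ : _ = L / x); last by rewrite /L; field; rewrite !gt_eqF.
  by apply=> t /Ax; rewrite NE.
apply: le_trans PAx _; rewrite -EFinD lee_fin /x invrK mulrA mulrDr mulr1 lerD2l.
by rewrite /k mulrA ler_pdivrMr// mulrC ler_pM2l// lerDl.
Qed.

End leading_block_of_product.

End gaussian_preconditioning.

Lemma gaussian_mx_sample_tr d (T : measurableType d) (R : realType)
    (P : probability T R) a b (mu sigma : R) (H : 'M[{RV P >-> R}]_(a, b)) :
  gaussian_matrix mu sigma H ->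
  gaussian_mx P (const_mx mu)^T sigma (fun t => (sample H t)^T).
Proof. by move=> /gaussian_matrixP; exact: gaussian_mx_tr. Qed.

(** The product has q rows, hence rank at most q, so a failure of the rank profile forces a singular
    leading block of size between 1 and q; each of these events is null. *)
Lemma generic_rank_profile_ae d (T : measurableType d) (R : realType)
    (P : probability T R) q m n (M : 'M[R]_(m, n)) (M0 : 'M[R]_(q, m)) (sigma : R)
    (Y : T -> 'M[R]_(q, m)) :
  0 < sigma -> gaussian_mx P M0 sigma Y ->
  (forall j, (1 <= j <= q)%N -> \rank (first_cols j M) = j) ->
  P [set t | generic_rank_profile (Y t *m M)] = 1%E.
Proof.
move=> sigma0 gY rankM.
have mB : measurable_mx (fun t => Y t *m M).
  by apply: measurable_mulmx (measurable_cst_mx _); exact: gaussian_mx_measurable gY.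
have mE := measurable_generic_rank_profile mB; set E := [set t | _] in mE *.
suff E0 : P (~` E) = 0%E.
  by rewrite -[E]setCK probability_setC ?E0 ?sube0//; exact: measurableC.
apply: measure_negligible; first exact: measurableC.
pose Z j := if (1 <= j <= q)%N
  then [set t | \det (leading_block j (Y t *m M)) = 0] else set0.
apply: (@negligibleS _ _ _ _ (\bigcup_j Z j)).
  move=> t; apply: contra_notP => Zt j /andP[j1 jr].
  have j1q : (1 <= j <= q)%N by rewrite j1 (leq_trans jr)// rank_leq_row.
  rewrite unitmxE unitfE; apply/negP => /eqP Nt0; apply: Zt.
  by exists j => //; rewrite /Z j1q.
apply: negligible_bigcup => j; rewrite /Z.
case: ifP => j1q; last exact: negligible_set0.
apply/negligibleP; last exact: (leading_block_det_neq0 sigma0 gY j1q (rankM j j1q)).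
apply: measurable_seteq => //; apply: measurable_det.
rewrite /leading_block /first_rows /first_cols.
apply: measurable_mulmx; first exact: measurable_cst_mx.
by apply: measurable_mulmx => //; exact: measurable_cst_mx.
Qed.

Theorem corollary4p2 (R : realType) (d : measure_display)
    (T : measurableType d) (P : probability T R)
    (m n q s : nat) (m_gt0 : (0 < m)%N) (n_gt0 : (0 < n)%N)
    (q_gt0 : (0 < q)%N) (s_gt0 : (0 < s)%N)
    (M : 'M[R]_(m, n)) (mu sigma y : R) (sigma_gt0 : 0 < sigma) (y_ge0 : 0 <= y)
    (G : 'M[{RV P >-> R}]_(q, m)) (H : 'M[{RV P >-> R}]_(n, s))
    (gaussG : gaussian_matrix mu sigma G) (gaussH : gaussian_matrix mu sigma H)
    (rank_cols : forall j : nat, (1 <= j <= q)%N -> \rank (first_cols j M) = j)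
    (rank_rows : forall k : nat, (1 <= k <= s)%N -> \rank (first_rows k M) = k) :
  (((q <= \rank M)%N ->
      P [set t | generic_rank_profile (sample G t *m M)] = 1%E) /\
   ((s <= \rank M)%N ->
      P [set t | generic_rank_profile (M *m sample H t)] = 1%E)) /\
  ((forall j : nat, (1 <= j <= q)%N -> (j <= \rank M)%N ->
      (prob_le P
         (fun t => 1 / spectral_norm
                         (moore_penrose (leading_block j (sample G t *m M))))%R y
       <= (235 / 100 * y * Num.sqrt j%:R
           * spectral_norm (moore_penrose (first_cols j M)) / sigma)%:E)%E) /\
   (forall k : nat, (1 <= k <= s)%N -> (k <= \rank M)%N ->
      (prob_le P
         (fun t => 1 / spectral_norm
                         (moore_penrose (leading_block k (M *m sample H t))))%R y
       <= (235 / 100 * y * Num.sqrt k%:R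
           * spectral_norm (moore_penrose (first_rows k M)) / sigma)%:E)%E)).

Proof.
have gG := gaussian_matrixP gaussG; have gH := gaussian_mx_sample_tr gaussH.
(* The claims on MH are those on GM for the transposes: leading blocks and pseudo-inverses commute
   with transposition, and the rank profile and the spectral norm are invariant under it. *)
have MHE t : M *m sample H t = ((sample H t)^T *m M^T)^T by rewrite trmx_mul !trmxK.
have rank_rowsT k : (1 <= k <= s)%N -> \rank (first_cols k M^T) = k.
  by move=> k1s; rewrite -[RHS](rank_rows k k1s) first_rows_tr mxrank_tr.
split; split.
- by move=> _; exact: generic_rank_profile_ae sigma_gt0 gG rank_cols.
- move=> _; rewrite -(generic_rank_profile_ae sigma_gt0 gH rank_rowsT).
  by congr (P _); apply/seteqP; split=> t /=; rewrite MHE => /generic_rank_profile_tr.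
- move=> j j1q _.
  exact: leading_block_inverse_bound sigma_gt0 gG j1q (rank_cols j j1q) _ y_ge0.
- move=> k k1s _.
  have := leading_block_inverse_bound sigma_gt0 gH k1s (rank_rowsT k k1s) y_ge0.
  rewrite /prob_le first_rows_tr moore_penrose_tr spectral_norm_tr.
  apply: le_trans; rewrite le_eqVlt; apply/orP; left; apply/eqP; congr (P _).
  apply/seteqP; split=> t /=;
    by rewrite MHE leading_block_tr moore_penrose_tr spectral_norm_tr.
Qed.
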